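(* Let $k$ be a commutative ring with unit, and let $(H,A,C)$ be a Doi-Koppinen datum over $k$, i.e. $H$ is a Hopf algebra, $A$ a left $H$-comodule algebra and $C$ a right $H$-module coalgebra. The following statements are equivalent: 1. there exists a total integral $\gamma : C\to \mathrm{Hom}(C,A)$ of $(H,A,C)$; 2. the natural transformation $\rho: F_A\circ 1_{{}^C\mathcal{M}(H)_A}\to F_A\circ (C\otimes\bullet)\circ F^C$ given by the left $C$-coactions $\rho_M: M\to C\otimes M$ splits, i.e. there is a natural transformation $\lambda: F_A\circ (C\otimes\bullet)\circ F^C\to F_A\circ 1_{{}^C\mathcal{M}(H)_A}$ with $\lambda_M\circ\rho_M=\mathrm{Id}_M$ for every $M\in {}^C\mathcal{M}(H)_A$; 3. the left $C$-coaction $\rho^l_{C\otimes A}: C\otimes A\to C\otimes C\otimes A$, $\rho^l_{C\otimes A}(c\otimes a)=\sum c_{(1)}\otimes c_{(2)}\otimes a$, splits in the category ${}^C\mathcal{M}^C$ of $C$-bicomodules, i.e. there is a $C$-bicomodule map $\lambda: C\otimes C\otimes A\to C\otimes A$ with $\lambda\circ\rho^l_{C\otimes A}=\mathrm{Id}$. Consequently, if one of the equivalent conditions holds, any Doi-Koppinen module $M\in{}^C\mathcal{M}(H)_A$ is relative injective as a left $C$-comodule.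
   Context: Throughout $\otimes$ and $\mathrm{Hom}$ are over $k$, $S$ is the antipode of $H$, and Sweedler notation is used: $\Delta(c)=\sum c_{(1)}\otimes c_{(2)}$; left coactions are written $\rho_M(m)=\sum m_{<-1>}\otimes m_{<0>}$, and iterated ones $\sum m_{<-2>}\otimes m_{<-1>}\otimes m_{<0>}$. A left $H$-comodule algebra is an algebra $A$ with a left $H$-coaction $\rho_A:A\to H\otimes A$ that is an algebra map. A right $H$-module coalgebra is a coalgebra $C$ with a right $H$-action such that $\Delta(c\cdot h)=\sum c_{(1)}\cdot h_{(1)}\otimes c_{(2)}\cdot h_{(2)}$ and $\varepsilon(c\cdot h)=\varepsilon(c)\varepsilon(h)$. ${}^C\mathcal{M}(H)_A$ is the category of (right-left) Doi-Koppinen modules: $k$-modules $M$ with a right $A$-action and a left $C$-coaction $\rho_M$ such that $\rho_M(ma)=\sum m_{<-1>}\cdot a_{<-1>}\otimes m_{<0>}a_{<0>}$ for all $m\in M,a\in A$; morphisms are the $A$-linear and $C$-colinear maps. $F_A:{}^C\mathcal{M}(H)_A\to{}^C\mathcal{M}$ is the functor to left $C$-comodules forgetting the $A$-action; $F^C:{}^C\mathcal{M}(H)_A\to\mathcal{M}_A$ is the functor to right $A$-modules forgetting the $C$-coaction; $C\otimes\bullet:\mathcal{M}_A\to{}^C\mathcal{M}(H)_A$ sends $M$ to $C\otimes M$ with $(c\otimes m)a=\sum c\cdot a_{<-1>}\otimes ma_{<0>}$ and coaction $c\otimes m\mapsto\sum c_{(1)}\otimes c_{(2)}\otimes m$. The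 coactions $\rho_M$ are morphisms of ${}^C\mathcal{M}(H)_A$, natural in $M$. An integral of $(H,A,C)$ is a $k$-linear map $\gamma:C\to\mathrm{Hom}(C,A)$ such that for all $c,d\in C$ $$\sum c_{(1)}\otimes\gamma(c_{(2)})(d)=\sum d_{(2)}\cdot\{\gamma(c)(d_{(1)})\}_{<-1>}\otimes\{\gamma(c)(d_{(1)})\}_{<0>};$$ it is total if $\sum\gamma(c_{(1)})(c_{(2)})=\varepsilon(c)1_A$ for all $c\in C$. $C$-bicomodule structures: $C\otimes A$ has left coaction $c\otimes a\mapsto\sum c_{(1)}\otimes c_{(2)}\otimes a$ and right coaction $c\otimes a\mapsto\sum c_{(1)}\otimes a_{<0>}\otimes c_{(2)}\cdot S(a_{<-1>})$; $C\otimes C\otimes A$ has left coaction $c\otimes d\otimes b\mapsto\sum c_{(1)}\otimes c_{(2)}\otimes d\otimes b$ and right coaction $c\otimes d\otimes b\mapsto\sum c\otimes d_{(1)}\otimes b_{<0>}\otimes d_{(2)}\cdot S(b_{<-1>})$. A left $C$-comodule $M$ is relative injective if for every $k$-split monomorphism $i:U\to V$ in ${}^C\mathcal{M}$ and every $C$-colinear $f:U\to M$ there is a $C$-colinear $g:V\to M$ with $g\circ i=f$. *)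

(* Defs.v *)
From HB Require Import structures.
From mathcomp Require Import all_boot all_order all_algebra.
From mathcomp Require Import boolp.

Set Implicit Arguments.
Unset Strict Implicit.
Unset Printing Implicit Defensive.

Import GRing.Theory.
Local Open Scope ring_scope.
Local Open Scope quotient_scope.

Reserved Notation "x ⊗ y" (at level 41, right associativity).
Reserved Notation "a ⋆ b" (at level 40, left associativity).
Reserved Notation "m ∙ a" (at level 40, left associativity).

(* The list [:: (m1, n1); ...; (mr, nr)] stands for the formal sum
   m1 ⊗ n1 + ... + mr ⊗ nr. Scalars need not be recorded, because
   a (m ⊗ n) = (a m) ⊗ n. The rules below present M ⊗ N as a commutative
   monoid; opposites come from -(m ⊗ n) = (- m) ⊗ n. *)
Inductive tens_eq (k : comPzRingType) (M N : lmodType k) :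
    seq (M * N) -> seq (M * N) -> Prop :=
  | TensRefl s : tens_eq s s
  | TensSym s t : tens_eq s t -> tens_eq t s
  | TensTrans s t u : tens_eq s t -> tens_eq t u -> tens_eq s u
  | TensCat s s' t t' : tens_eq s s' -> tens_eq t t' ->
      tens_eq (s ++ t) (s' ++ t')
  | TensC s t : tens_eq (s ++ t) (t ++ s)
  | TensDl m m' n : tens_eq [:: (m + m', n)] [:: (m, n); (m', n)]
  | TensDr m n n' : tens_eq [:: (m, n + n')] [:: (m, n); (m, n')]
  | TensZ a m n : tens_eq [:: (a *: m, n)] [:: (m, a *: n)]
  | Tens0 n : tens_eq [:: (0, n)] [::].

Section Tensor.
Variables (k : comPzRingType) (M N : lmodType k).

Definition tens_rel : rel (seq (M * N)) := fun s t => `[< tens_eq s t >].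

Fact tens_rel_refl : reflexive tens_rel.
Proof. by move=> s; apply/asboolP; exact: TensRefl. Qed.

Fact tens_rel_sym : symmetric tens_rel.
Proof. by move=> s t; apply/asboolP/asboolP; exact: TensSym. Qed.

Fact tens_rel_trans : transitive tens_rel.
Proof.
by move=> t s u /asboolP st /asboolP tu; apply/asboolP; exact: TensTrans st tu.
Qed.

Canonical tens_equiv :=
  EquivRel tens_rel tens_rel_refl tens_rel_sym tens_rel_trans.

Definition tensor : Type := {eq_quot tens_equiv}.
HB.instance Definition _ := EqQuotient.on tensor.
HB.instance Definition _ := Choice.on tensor.

Definition tens (m : M) (n : N) : tensor := \pi_tensor [:: (m, n)].

Lemma tens_surj (x : tensor) : exists s, x = \pi_tensor s.
Proof. by exists (repr x); rewrite reprK. Qed.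

Lemma tens_piP s t : \pi_tensor s = \pi_tensor t <-> tens_eq s t.
Proof.
split=> [/eqP|st]; first by rewrite eqmodE => /asboolP.
by apply/eqP; rewrite eqmodE; apply/asboolP.
Qed.

Lemma tens_reprP s : tens_eq (repr (\pi_tensor s)) s.
Proof. by apply/tens_piP; rewrite reprK. Qed.

Lemma tens_eq_map (f : M * N -> M * N) s t :
  (forall m m' n, tens_eq [:: f (m + m', n)] [:: f (m, n); f (m', n)]) ->
  (forall m n n', tens_eq [:: f (m, n + n')] [:: f (m, n); f (m, n')]) ->
  (forall a m n, tens_eq [:: f (a *: m, n)] [:: f (m, a *: n)]) ->
  (forall n, tens_eq [:: f (0, n)] [::]) ->
  tens_eq s t -> tens_eq (map f s) (map f t).
Proof.
move=> fDl fDr fZ f0; elim=> {s t}.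
- by move=> s; exact: TensRefl.
- by move=> s t _; exact: TensSym.
- by move=> s t u _ st _ tu; exact: TensTrans st tu.
- by move=> s s' t t' _ ss' _ tt'; rewrite !map_cat; exact: TensCat.
- by move=> s t; rewrite !map_cat; exact: TensC.
- by move=> m m' n; exact: fDl.
- by move=> m n n'; exact: fDr.
- by move=> a m n; exact: fZ.
- by move=> n; exact: f0.
Qed.

Definition scale_pair (a : k) (p : M * N) := (a *: p.1, p.2).

Lemma tens_eq_scale a s t :
  tens_eq s t -> tens_eq (map (scale_pair a) s) (map (scale_pair a) t).
Proof.
apply: tens_eq_map => [m m' n|m n n'|b m n|n]; rewrite /scale_pair /=.
- by rewrite scalerDr; exact: TensDl.
- exact: TensDr.
- by rewrite scalerA mulrC -scalerA; exact: TensZ.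
- by rewrite scaler0; exact: Tens0.
Qed.

Definition tens0 : tensor := \pi_tensor [::].
Definition tens_add (x y : tensor) : tensor := \pi_tensor (repr x ++ repr y).
Definition tens_scale (a : k) (x : tensor) : tensor :=
  \pi_tensor (map (scale_pair a) (repr x)).
Definition tens_opp : tensor -> tensor := tens_scale (-1).

Lemma tens_addE s t :
  tens_add (\pi_tensor s) (\pi_tensor t) = \pi_tensor (s ++ t).
Proof. by apply/tens_piP; apply: TensCat; exact: tens_reprP. Qed.

Lemma tens_scaleE a s :
  tens_scale a (\pi_tensor s) = \pi_tensor (map (scale_pair a) s).
Proof. by apply/tens_piP; apply: tens_eq_scale; exact: tens_reprP. Qed.

Fact tens_addA : associative tens_add.
Proof.
move=> x y z; case: (tens_surj x) => s ->; case: (tens_surj y) => t ->.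
case: (tens_surj z) => u ->.
by rewrite !tens_addE catA.
Qed.

Fact tens_addC : commutative tens_add.
Proof.
move=> x y; case: (tens_surj x) => s ->; case: (tens_surj y) => t ->.
rewrite !tens_addE.
by apply/tens_piP; exact: TensC.
Qed.

Fact tens_add0 : left_id tens0 tens_add.
Proof. by move=> x; case: (tens_surj x) => s ->; rewrite tens_addE. Qed.

Fact tens_scaleDl x a b :
  tens_scale (a + b) x = tens_add (tens_scale a x) (tens_scale b x).
Proof.
case: (tens_surj x) => s ->; rewrite !tens_scaleE tens_addE; apply/tens_piP.
elim: s => [|[m n] s IHs] /=; first exact: TensRefl.
rewrite /scale_pair /= scalerDl -cat1s.
apply: (TensTrans (TensCat (TensDl _ _ _) IHs)).
rewrite -[_ :: (_ ++ _)]cat1s -[[:: _; _]]cat1s -catA.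
apply: TensCat; first exact: TensRefl.
rewrite -[(b *: m, n) :: map _ _]cat1s !catA.
by apply: TensCat; [exact: TensC | exact: TensRefl].
Qed.

Fact tens_scale0 x : tens_scale 0 x = tens0.
Proof.
case: (tens_surj x) => s ->; rewrite tens_scaleE; apply/tens_piP.
elim: s => [|[m n] s IHs] /=; first exact: TensRefl.
rewrite /scale_pair /= scale0r -cat1s -[X in tens_eq _ X]cats0.
by apply: TensCat => //; exact: Tens0.
Qed.

Fact tens_scale1 : left_id 1 tens_scale.
Proof.
move=> x; case: (tens_surj x) => s ->; rewrite tens_scaleE.
rewrite -[in RHS](map_id s); congr (\pi_tensor _).
by apply: eq_map => -[m n]; rewrite /scale_pair scale1r.
Qed.

Fact tens_addN : left_inverse tens0 tens_opp tens_add.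
Proof.
move=> x; rewrite -[in X in tens_add _ X](tens_scale1 x) -tens_scaleDl.
by rewrite addNr tens_scale0.
Qed.

HB.instance Definition _ :=
  GRing.isZmodule.Build tensor tens_addA tens_addC tens_add0 tens_addN.

Fact tens_scaleA a b x : tens_scale a (tens_scale b x) = tens_scale (a * b) x.
Proof.
case: (tens_surj x) => s ->; rewrite !tens_scaleE -map_comp; congr (\pi_tensor _).
by apply: eq_map => -[m n]; rewrite /scale_pair /= scalerA.
Qed.

Fact tens_scaleDr : right_distributive tens_scale +%R.
Proof.
move=> a x y; case: (tens_surj x) => s ->; case: (tens_surj y) => t ->.
by rewrite [_ + _]tens_addE !tens_scaleE [RHS]tens_addE map_cat.
Qed.

Fact tens_scaleDl' x : {morph tens_scale^~ x : a b / a + b}.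
Proof. by move=> a b; exact: tens_scaleDl. Qed.

HB.instance Definition _ := GRing.Zmodule_isLmodule.Build k tensor
  tens_scaleA tens_scale1 tens_scaleDr tens_scaleDl'.

Lemma tens_piE s : \pi_tensor s = \sum_(p <- s) tens p.1 p.2.
Proof.
elim: s => [|[m n] s IHs]; first by rewrite big_nil.
by rewrite big_cons -IHs /= [_ + _]tens_addE.
Qed.

Lemma tensE (x : tensor) : x = \sum_(p <- repr x) tens p.1 p.2.
Proof. by rewrite -tens_piE reprK. Qed.

Lemma tens_linearl n : linear (tens^~ n).
Proof.
move=> a m m'; rewrite [a *: (tens m n)]tens_scaleE [RHS]tens_addE /=.
by apply/tens_piP; exact: TensDl.
Qed.

Lemma tens_linearr m : linear (tens m).
Proof.
move=> a n n'; rewrite [a *: (tens m n)]tens_scaleE [RHS]tens_addE /=.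
apply/tens_piP; apply: (TensTrans (TensDr _ _ _)); rewrite -cat1s.
apply: (TensCat (TensSym (TensZ _ _ _))); exact: TensRefl.
Qed.

End Tensor.
Arguments tensor {k} (M N)%_type_scope.

Notation "M ⊗ N" := (tensor M N) : type_scope.
Notation "x ⊗ y" := (tens x y) : ring_scope.

(* Sweedler notation: \sw_(x, y <- t) f x y is the sum of the f x_i y_i for a
   chosen expression t = \sum_i x_i ⊗ y_i. When f is bilinear, the case in all
   uses below, it does not depend on that expression (sweedler_tens,
   sweedler_linear). *)
Definition sweedler (k : comPzRingType) (M N : lmodType k) (P : nmodType)
    (t : M ⊗ N) (f : M -> N -> P) : P :=
  \sum_(p <- repr t) f p.1 p.2.

Notation "\sw_ ( x , y <- t ) e" := (sweedler t (fun x y => e))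
  (at level 41, x name, y name, t at level 200, e at level 41,
   format "\sw_ ( x ,  y  <-  t )  e") : ring_scope.

Definition bilin (k : comPzRingType) (M N P : lmodType k) (f : M -> N -> P) :=
  (forall n, linear (f^~ n)) /\ (forall m, linear (f m)).

Section Sweedler.
Variable k : comPzRingType.
Implicit Types M N P Q : lmodType k.

Lemma sweedler_pi M N P (f : M -> N -> P) s :
  bilin f -> sweedler (\pi_(M ⊗ N) s) f = \sum_(p <- s) f p.1 p.2.
Proof.
case=> fl fr; rewrite /sweedler.
have fDl n m m' : f (m + m') n = f m n + f m' n.
  by have:= fl n 1 m m'; rewrite !scale1r.
have fDr m n n' : f m (n + n') = f m n + f m n'.
  by have:= fr m 1 n n'; rewrite !scale1r.
have f0 n : f 0 n = 0.
  by apply: (addIr (f 0 n)); rewrite -fDl !add0r.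
have f0r m : f m 0 = 0.
  by apply: (addIr (f m 0)); rewrite -fDr !add0r.
have fZl a m n : f (a *: m) n = a *: f m n.
  by have:= fl n a m 0; rewrite !f0 !addr0.
have fZr a m n : f m (a *: n) = a *: f m n.
  by have:= fr m a n 0; rewrite !f0r !addr0.
move: (repr _) (tens_reprP s) => r; elim=> {r s}//.
- by move=> s t u _ -> _ ->.
- by move=> s s' t t' _ e _ e'; rewrite !big_cat /= e e'.
- by move=> s t; rewrite !big_cat /= addrC.
- by move=> m m' n; rewrite !big_cons !big_nil /= !addr0.
- by move=> m n n'; rewrite !big_cons !big_nil /= !addr0.
- by move=> a m n; rewrite !big_cons !big_nil /= fZl fZr.
- by move=> n; rewrite !big_cons !big_nil /= f0 addr0.
Qed.

Lemma sweedler_tens M N P (f : M -> N -> P) m n :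
  bilin f -> sweedler (m ⊗ n) f = f m n.
Proof. by move=> fP; rewrite sweedler_pi // big_seq1. Qed.

Lemma sweedler_linear M N P (f : M -> N -> P) :
  bilin f -> linear (fun t => sweedler t f).
Proof.
move=> fP a x y; case: (tens_surj x) => s ->; case: (tens_surj y) => t ->.
rewrite [a *: _]tens_scaleE [_ + _]tens_addE !sweedler_pi //.
rewrite big_cat big_map /= scaler_sumr; congr (_ + _); apply: eq_bigr => -[m n] _.
case: fP => fl _ /=; have := fl n a m 0; rewrite addr0 => ->.
suff -> : f 0 n = 0 by rewrite addr0.
have := fl n 1 0 0; rewrite !scale1r addr0 => e.
by apply: (addIr (f 0 n)); rewrite -e add0r.
Qed.

Lemma sweedler_id M N (t : M ⊗ N) : \sw_(x, y <- t) (x ⊗ y) = t.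
Proof. by rewrite [RHS]tensE. Qed.

End Sweedler.

(* The algType of ssralg excludes the zero algebra; k and the algebras over it
   may be trivial here, whence a separate structure. *)
HB.mixin Record Lmodule_isKAlgebra (k : comPzRingType) A
    of GRing.Lmodule k A := {
  kmul : A -> A -> A;
  kone : A;
  kmul_linearl_subproof : forall b : A, linear (kmul^~ b);
  kmul_linearr_subproof : forall a : A, linear (kmul a);
  kmulA_subproof : associative kmul;
  kmul1l_subproof : left_id kone kmul;
  kmul1r_subproof : right_id kone kmul
}.

#[short(type="kalgType")]
HB.structure Definition KAlgebra (k : comPzRingType) :=
  {A of GRing.Lmodule k A & Lmodule_isKAlgebra k A}.

Notation "a ⋆ b" := (kmul a b) : ring_scope.

Lemma kmul_linearl (k : comPzRingType) (A : kalgType k) :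
  forall b : A, linear (kmul^~ b).
Proof. exact: kmul_linearl_subproof. Qed.

Lemma kmul_linearr (k : comPzRingType) (A : kalgType k) :
  forall a : A, linear (kmul a).
Proof. exact: kmul_linearr_subproof. Qed.

Lemma kmulA (k : comPzRingType) (A : kalgType k) :
  associative (@kmul k A).
Proof. exact: kmulA_subproof. Qed.

Lemma kmul1l (k : comPzRingType) (A : kalgType k) :
  left_id kone (@kmul k A).
Proof. exact: kmul1l_subproof. Qed.

Lemma kmul1r (k : comPzRingType) (A : kalgType k) :
  right_id kone (@kmul k A).
Proof. exact: kmul1r_subproof. Qed.

(* Structures whose operations are bundled linear maps are given in two steps:
   the mixin fields (_subdef, _subproof) are stated for a bare type, and the
   operations and laws to be used are restated for the bundled structure. *)
HB.mixin Record Lmodule_isCoalgebra (k : comPzRingType) C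
    of GRing.Lmodule k C := {
  comul_subdef : {linear C -> (C ⊗ C)%type};
  counit_subdef : {scalar C};
  comulA_subproof : forall c : C,
    \sw_(c1, c2 <- comul_subdef c) (c1 ⊗ comul_subdef c2)
      = \sw_(c1, c3 <- comul_subdef c)
          \sw_(c11, c12 <- comul_subdef c1) (c11 ⊗ (c12 ⊗ c3));
  counitl_subproof : forall c : C,
    \sw_(c1, c2 <- comul_subdef c) (counit_subdef c1 *: c2) = c;
  counitr_subproof : forall c : C,
    \sw_(c1, c2 <- comul_subdef c) (counit_subdef c2 *: c1) = c
}.

#[short(type="coalgType")]
HB.structure Definition Coalgebra (k : comPzRingType) :=
  {C of GRing.Lmodule k C & Lmodule_isCoalgebra k C}.

Definition comul (k : comPzRingType) (C : coalgType k) :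
  {linear C -> (C ⊗ C)%type} := comul_subdef.
Arguments comul {k C}.

Definition counit (k : comPzRingType) (C : coalgType k) :
  {scalar C} := counit_subdef.
Arguments counit {k C}.

Lemma comulA (k : comPzRingType) (C : coalgType k) :
  forall c : C,
    \sw_(c1, c2 <- comul c) (c1 ⊗ comul c2)
      = \sw_(c1, c3 <- comul c) \sw_(c11, c12 <- comul c1) (c11 ⊗ (c12 ⊗ c3)).
Proof. exact: comulA_subproof. Qed.

Lemma counitl (k : comPzRingType) (C : coalgType k) :
  forall c : C, \sw_(c1, c2 <- comul c) (counit c1 *: c2) = c.
Proof. exact: counitl_subproof. Qed.

Lemma counitr (k : comPzRingType) (C : coalgType k) :
  forall c : C, \sw_(c1, c2 <- comul c) (counit c2 *: c1) = c.
Proof. exact: counitr_subproof. Qed.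

HB.mixin Record KAlgebra_Coalgebra_isHopf (k : comPzRingType) H
    of KAlgebra k H & Coalgebra k H := {
  comulM_subproof : forall g h : H, comul (g ⋆ h)
    = \sw_(g1, g2 <- comul g) \sw_(h1, h2 <- comul h) ((g1 ⋆ h1) ⊗ (g2 ⋆ h2));
  comul1_subproof : comul (kone : H) = kone ⊗ kone;
  counitM_subproof : forall g h : H, counit (g ⋆ h) = counit g * counit h;
  counit1_subproof : counit (kone : H) = 1;
  antipode_subdef : {linear H -> H};
  antipodel_subproof : forall h : H,
    \sw_(h1, h2 <- comul h) (antipode_subdef h1 ⋆ h2) = counit h *: kone;
  antipoder_subproof : forall h : H,
    \sw_(h1, h2 <- comul h) (h1 ⋆ antipode_subdef h2) = counit h *: kone
}.

#[short(type="hopfType")]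
HB.structure Definition Hopf (k : comPzRingType) :=
  {H of KAlgebra k H & Coalgebra k H & KAlgebra_Coalgebra_isHopf k H}.

Definition antipode (k : comPzRingType) (H : hopfType k) :
  {linear H -> H} := antipode_subdef.
Arguments antipode {k H}.

Lemma comulM (k : comPzRingType) (H : hopfType k) :
  forall g h : H, comul (g ⋆ h)
    = \sw_(g1, g2 <- comul g) \sw_(h1, h2 <- comul h) ((g1 ⋆ h1) ⊗ (g2 ⋆ h2)).
Proof. exact: comulM_subproof. Qed.

Lemma comul1 (k : comPzRingType) (H : hopfType k) :
  comul (kone : H) = kone ⊗ kone.
Proof. exact: comul1_subproof. Qed.

Lemma counitM (k : comPzRingType) (H : hopfType k) :
  forall g h : H, counit (g ⋆ h) = counit g * counit h.
Proof. exact: counitM_subproof. Qed.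

Lemma counit1 (k : comPzRingType) (H : hopfType k) :
  counit (kone : H) = 1.
Proof. exact: counit1_subproof. Qed.

Lemma antipodel (k : comPzRingType) (H : hopfType k) :
  forall h : H,
    \sw_(h1, h2 <- comul h) (antipode h1 ⋆ h2) = counit h *: kone.
Proof. exact: antipodel_subproof. Qed.

Lemma antipoder (k : comPzRingType) (H : hopfType k) :
  forall h : H,
    \sw_(h1, h2 <- comul h) (h1 ⋆ antipode h2) = counit h *: kone.
Proof. exact: antipoder_subproof. Qed.

HB.mixin Record Lmodule_isRModule (k : comPzRingType) (A : kalgType k) M
    of GRing.Lmodule k M := {
  ract : M -> A -> M;
  ract_linearl_subproof : forall a : A, linear (ract^~ a);
  ract_linearr_subproof : forall m : M, linear (ract m);
  ractA_subproof : forall (m : M) (a b : A), ract m (a ⋆ b) = ract (ract m a) b;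
  ract1_subproof : forall m : M, ract m kone = m
}.

#[short(type="rmoduleType")]
HB.structure Definition RModule (k : comPzRingType) (A : kalgType k) :=
  {M of GRing.Lmodule k M & Lmodule_isRModule k A M}.

Notation "m ∙ a" := (ract m a) : ring_scope.

Lemma ract_linearl (k : comPzRingType) (A : kalgType k) (M : rmoduleType A) :
  forall a : A, linear (fun m : M => ract m a).
Proof. exact: ract_linearl_subproof. Qed.

Lemma ract_linearr (k : comPzRingType) (A : kalgType k) (M : rmoduleType A) :
  forall m : M, linear (ract m).
Proof. exact: ract_linearr_subproof. Qed.

Lemma ractA (k : comPzRingType) (A : kalgType k) (M : rmoduleType A) :
  forall (m : M) (a b : A), ract m (a ⋆ b) = ract (ract m a) b.
Proof. exact: ractA_subproof. Qed.

Lemma ract1 (k : comPzRingType) (A : kalgType k) (M : rmoduleType A) :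
  forall m : M, ract m kone = m.
Proof. exact: ract1_subproof. Qed.

HB.mixin Record Lmodule_isLComodule (k : comPzRingType) (C : coalgType k) M
    of GRing.Lmodule k M := {
  lcoact_subdef : {linear M -> (C ⊗ M)%type};
  lcoactA_subproof : forall m : M,
    \sw_(c, n <- lcoact_subdef m) (c ⊗ lcoact_subdef n)
      = \sw_(c, n <- lcoact_subdef m) \sw_(c1, c2 <- comul c) (c1 ⊗ (c2 ⊗ n));
  lcoact_counit_subproof : forall m : M,
    \sw_(c, n <- lcoact_subdef m) (counit c *: n) = m
}.

#[short(type="lcomodType")]
HB.structure Definition LComodule (k : comPzRingType) (C : coalgType k) :=
  {M of GRing.Lmodule k M & Lmodule_isLComodule k C M}.

Definition lcoact (k : comPzRingType) (C : coalgType k) (M : lcomodType C) :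
  {linear M -> (C ⊗ M)%type} := lcoact_subdef.
Arguments lcoact {k C M}.

Lemma lcoactA (k : comPzRingType) (C : coalgType k) (M : lcomodType C) :
  forall m : M,
    \sw_(c, n <- lcoact m) (c ⊗ lcoact n)
      = \sw_(c, n <- lcoact m) \sw_(c1, c2 <- comul c) (c1 ⊗ (c2 ⊗ n)).
Proof. exact: lcoactA_subproof. Qed.

Lemma lcoact_counit (k : comPzRingType) (C : coalgType k) (M : lcomodType C) :
  forall m : M, \sw_(c, n <- lcoact m) (counit c *: n) = m.
Proof. exact: lcoact_counit_subproof. Qed.

HB.mixin Record Lmodule_isRComodule (k : comPzRingType) (C : coalgType k) M
    of GRing.Lmodule k M := {
  rcoact_subdef : {linear M -> (M ⊗ C)%type};
  rcoactA_subproof : forall m : M,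
    \sw_(n, c <- rcoact_subdef m)
      \sw_(n', c' <- rcoact_subdef n) (n' ⊗ (c' ⊗ c))
      = \sw_(n, c <- rcoact_subdef m) (n ⊗ comul c);
  rcoact_counit_subproof : forall m : M,
    \sw_(n, c <- rcoact_subdef m) (counit c *: n) = m
}.

#[short(type="rcomodType")]
HB.structure Definition RComodule (k : comPzRingType) (C : coalgType k) :=
  {M of GRing.Lmodule k M & Lmodule_isRComodule k C M}.

Definition rcoact (k : comPzRingType) (C : coalgType k) (M : rcomodType C) :
  {linear M -> (M ⊗ C)%type} := rcoact_subdef.
Arguments rcoact {k C M}.

Lemma rcoactA (k : comPzRingType) (C : coalgType k) (M : rcomodType C) :
  forall m : M,
    \sw_(n, c <- rcoact m) \sw_(n', c' <- rcoact n) (n' ⊗ (c' ⊗ c))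
      = \sw_(n, c <- rcoact m) (n ⊗ comul c).
Proof. exact: rcoactA_subproof. Qed.

Lemma rcoact_counit (k : comPzRingType) (C : coalgType k) (M : rcomodType C) :
  forall m : M, \sw_(n, c <- rcoact m) (counit c *: n) = m.
Proof. exact: rcoact_counit_subproof. Qed.

HB.mixin Record LRComodule_isBicomodule (k : comPzRingType) (C : coalgType k) M
    of LComodule k C M & RComodule k C M := {
  lrcoactA_subproof : forall m : M,
    \sw_(n, d <- rcoact m) \sw_(c, p <- lcoact n) (c ⊗ (p ⊗ d))
      = \sw_(c, n <- lcoact m) (c ⊗ rcoact n)
}.

#[short(type="bicomodType")]
HB.structure Definition Bicomodule (k : comPzRingType) (C : coalgType k) :=
  {M of LComodule k C M & RComodule k C M
      & LRComodule_isBicomodule k C M}.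

Lemma lrcoactA (k : comPzRingType) (C : coalgType k) (M : bicomodType C) :
  forall m : M,
    \sw_(n, d <- rcoact m) \sw_(c, p <- lcoact n) (c ⊗ (p ⊗ d))
      = \sw_(c, n <- lcoact m) (c ⊗ rcoact n).
Proof. exact: lrcoactA_subproof. Qed.

HB.mixin Record LComodule_isComodAlgebra (k : comPzRingType) (H : hopfType k) A
    of KAlgebra k A & LComodule k H A := {
  lcoactM_subproof : forall a b : A, lcoact (a ⋆ b)
    = \sw_(g, a0 <- lcoact a) \sw_(h, b0 <- lcoact b) ((g ⋆ h) ⊗ (a0 ⋆ b0));
  lcoact1_subproof : lcoact (kone : A) = kone ⊗ kone
}.

#[short(type="comodAlgType")]
HB.structure Definition ComodAlgebra (k : comPzRingType) (H : hopfType k) :=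
  {A of KAlgebra k A & LComodule k H A & LComodule_isComodAlgebra k H A}.

Lemma lcoactM (k : comPzRingType) (H : hopfType k) (A : comodAlgType H) :
  forall a b : A, lcoact (a ⋆ b)
    = \sw_(g, a0 <- lcoact a) \sw_(h, b0 <- lcoact b) ((g ⋆ h) ⊗ (a0 ⋆ b0)).
Proof. exact: lcoactM_subproof. Qed.

Lemma lcoact1 (k : comPzRingType) (H : hopfType k) (A : comodAlgType H) :
  lcoact (kone : A) = kone ⊗ kone.
Proof. exact: lcoact1_subproof. Qed.

HB.mixin Record Coalgebra_isModCoalgebra (k : comPzRingType) (H : hopfType k) C
    of Coalgebra k C & RModule k H C := {
  comul_ract_subproof : forall (c : C) (h : H), comul (c ∙ h)
    = \sw_(c1, c2 <- comul c) \sw_(h1, h2 <- comul h) ((c1 ∙ h1) ⊗ (c2 ∙ h2));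
  counit_ract_subproof : forall (c : C) (h : H),
    counit (c ∙ h) = counit c * counit h
}.

#[short(type="modCoalgType")]
HB.structure Definition ModCoalgebra (k : comPzRingType) (H : hopfType k) :=
  {C of Coalgebra k C & RModule k H C & Coalgebra_isModCoalgebra k H C}.

Lemma comul_ract (k : comPzRingType) (H : hopfType k) (C : modCoalgType H) :
  forall (c : C) (h : H), comul (c ∙ h)
    = \sw_(c1, c2 <- comul c) \sw_(h1, h2 <- comul h) ((c1 ∙ h1) ⊗ (c2 ∙ h2)).
Proof. exact: comul_ract_subproof. Qed.

Lemma counit_ract (k : comPzRingType) (H : hopfType k) (C : modCoalgType H) :
  forall (c : C) (h : H), counit (c ∙ h) = counit c * counit h.
Proof. exact: counit_ract_subproof. Qed.

HB.mixin Record RModule_LComodule_isDoiKoppinen (k : comPzRingType)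
    (H : hopfType k) (A : comodAlgType H) (C : modCoalgType H) M
    of RModule k A M & LComodule k C M := {
  lcoact_ract_subproof : forall (m : M) (a : A), lcoact (m ∙ a)
    = \sw_(c, m0 <- lcoact m) \sw_(h, a0 <- lcoact a) ((c ∙ h) ⊗ (m0 ∙ a0))
}.

#[short(type="doiKoppinenType")]
HB.structure Definition DoiKoppinen (k : comPzRingType)
    (H : hopfType k) (A : comodAlgType H) (C : modCoalgType H) :=
  {M of RModule k A M & LComodule k C M
      & RModule_LComodule_isDoiKoppinen k H A C M}.

Lemma lcoact_ract (k : comPzRingType) (H : hopfType k)
    (A : comodAlgType H) (C : modCoalgType H) (M : doiKoppinenType A C) :
  forall (m : M) (a : A), lcoact (m ∙ a)
    = \sw_(c, m0 <- lcoact m) \sw_(h, a0 <- lcoact a) ((c ∙ h) ⊗ (m0 ∙ a0)).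
Proof. exact: lcoact_ract_subproof. Qed.

Section MultilinearCalculus.
Variable k : comPzRingType.
Implicit Types L M N P Q : lmodType k.

Lemma lin0 M N (f : M -> N) : linear f -> f 0 = 0.
Proof.
move=> fP; have := fP (-1) 0 0; rewrite scaleN1r addr0 oppr0 => e.
by rewrite {1}e scaleN1r addNr.
Qed.

Lemma linZ M N (f : M -> N) a x : linear f -> f (a *: x) = a *: f x.
Proof. by move=> fP; have := fP a x 0; rewrite (lin0 fP) !addr0. Qed.

Lemma tensZl M N a (m : M) (n : N) : (a *: m) ⊗ n = a *: (m ⊗ n).
Proof. exact: (linZ _ _ (tens_linearl n)). Qed.

Lemma tensZr M N a (m : M) (n : N) : m ⊗ (a *: n) = a *: (m ⊗ n).
Proof. exact: (linZ _ _ (tens_linearr m)). Qed.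

Lemma lin_id M : linear (fun z : M => z).
Proof. by []. Qed.

Lemma lin_comp M N P (f : {linear N -> P}) (g : M -> N) :
  linear g -> linear (fun z => f (g z)).
Proof. by move=> gP a x y; rewrite gP linearP. Qed.

Lemma lin_tensl M N P (g : M -> N) (p : P) :
  linear g -> linear (fun z => g z ⊗ p).
Proof. by move=> gP a x y; rewrite gP tens_linearl. Qed.

Lemma lin_tensr M N P (g : M -> N) (p : P) :
  linear g -> linear (fun z => p ⊗ g z).
Proof. by move=> gP a x y; rewrite gP tens_linearr. Qed.

Lemma lin_kmull M (A : kalgType k) (g : M -> A) (b : A) :
  linear g -> linear (fun z => g z ⋆ b).
Proof. by move=> gP a x y; rewrite gP kmul_linearl. Qed.

Lemma lin_kmulr M (A : kalgType k) (g : M -> A) (b : A) :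
  linear g -> linear (fun z => b ⋆ g z).
Proof. by move=> gP a x y; rewrite gP kmul_linearr. Qed.

Lemma lin_ractl M (A : kalgType k) (N : rmoduleType A) (g : M -> N) (b : A) :
  linear g -> linear (fun z => g z ∙ b).
Proof. by move=> gP a x y; rewrite gP ract_linearl. Qed.

Lemma lin_ractr M (A : kalgType k) (N : rmoduleType A) (g : M -> A) (n : N) :
  linear g -> linear (fun z => n ∙ g z).
Proof. by move=> gP a x y; rewrite gP ract_linearr. Qed.

Lemma lin_scale M N (a : k) (g : M -> N) :
  linear g -> linear (fun z => a *: g z).
Proof. by move=> gP b x y; rewrite gP scalerDr !scalerA mulrC. Qed.

Lemma lin_scalar M N (f : {scalar M}) (g : N -> M) P (p : P) :
  linear g -> linear (fun z => f (g z) *: p).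
Proof. by move=> gP a x y; rewrite gP linearP scalerDl scalerA. Qed.

Lemma lin_sweedler L M N P (t : M ⊗ N) (f : L -> M -> N -> P) :
  (forall x y, linear (fun z => f z x y)) ->
  linear (fun z => sweedler t (f z)).
Proof.
move=> fP a x y; rewrite /sweedler scaler_sumr -big_split /=.
by apply: eq_bigr => p _; exact: fP.
Qed.

Lemma lin_sweedler_arg L M N P (g : L -> M ⊗ N) (f : M -> N -> P) :
  bilin f -> linear g -> linear (fun z => sweedler (g z) f).
Proof. by move=> fP gP a x y; rewrite gP sweedler_linear. Qed.

Lemma sweedler_lin M N P Q (g : P -> Q) (t : M ⊗ N) (f : M -> N -> P) :
  linear g -> g (sweedler t f) = \sw_(x, y <- t) g (f x y).
Proof.
move=> gP; rewrite /sweedler; apply: (big_morph g); last exact: lin0.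
move=> x y.
by have := gP 1 x y; rewrite !scale1r.
Qed.

Lemma sweedler_sweedler M N P Q L (t : M ⊗ N) (f : M -> N -> P ⊗ Q)
    (g : P -> Q -> L) : bilin g ->
  sweedler (sweedler t f) g = \sw_(x, y <- t) sweedler (f x y) g.
Proof.
by move=> gP; apply: (@sweedler_lin _ _ _ _ (fun u => sweedler u g));
  exact: sweedler_linear.
Qed.

Lemma eq_sweedler M N P (t : M ⊗ N) (f g : M -> N -> P) :
  (forall x y, f x y = g x y) -> sweedler t f = sweedler t g.
Proof. by move=> fg; apply: eq_bigr => p _. Qed.

Lemma exchange_sweedler L M N P Q (t : M ⊗ N) (u : P ⊗ Q)
    (f : M -> N -> P -> Q -> L) :
  \sw_(x, y <- t) \sw_(v, w <- u) f x y v w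
    = \sw_(v, w <- u) \sw_(x, y <- t) f x y v w.
Proof. by rewrite /sweedler exchange_big. Qed.

Lemma scale_sweedler M N P (a : k) (t : M ⊗ N) (f : M -> N -> P) :
  a *: sweedler t f = \sw_(x, y <- t) (a *: f x y).
Proof. exact: scaler_sumr. Qed.

Lemma tensor_ext M N P (f g : M ⊗ N -> P) : linear f -> linear g ->
  (forall x y, f (x ⊗ y) = g (x ⊗ y)) -> forall t, f t = g t.
Proof.
move=> fP gP fg t; rewrite -(sweedler_id t).
by rewrite (sweedler_lin _ _ fP) (sweedler_lin _ _ gP); apply: eq_sweedler.
Qed.

End MultilinearCalculus.

Lemma counit_antipode (k : comPzRingType) (H : hopfType k) (h : H) :
  counit (antipode h) = counit h.
Proof.
have e : counit (\sw_(h1, h2 <- comul h) (antipode h1 ⋆ h2)) = counit h.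
  by rewrite antipodel linearZ /= counit1 mulr1.
rewrite -{}e -[in LHS](counitr h) /sweedler !raddf_sum /=.
by apply: eq_bigr => p _; rewrite counitM !linearZ /= mulrC.
Qed.

(* Otherwise unification unfolds the quotients. *)
Opaque tens sweedler.

Ltac lin := cbv beta; lazymatch goal with
  | |- bilin _ => split=> ?; lin
  | |- forall _, _ => move=> ?; lin
  | |- GRing.linear_for _ (fun z => z) => exact: lin_id
  | |- GRing.linear_for _ (fun z => @tens _ _ _ (@?g z) _) =>
      lazymatch g with
      | (fun _ => ?a) => apply: lin_tensr | _ => apply: lin_tensl
      end; lin
  | |- GRing.linear_for _ (fun z => @kmul _ _ (@?g z) _) =>
      lazymatch g with
      | (fun _ => ?a) => apply: lin_kmulr | _ => apply: lin_kmull
      end; lin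
  | |- GRing.linear_for _ (fun z => @ract _ _ _ (@?g z) _) =>
      lazymatch g with
      | (fun _ => ?a) => apply: lin_ractr | _ => apply: lin_ractl
      end; lin
  | |- GRing.linear_for _ (fun z => @GRing.scale _ _ (@?g z) _) =>
      lazymatch g with
      | (fun _ => ?a) => apply: lin_scale | _ => apply: lin_scalar
      end; lin
  | |- GRing.linear_for _ (fun z => @sweedler _ _ _ _ (@?g z) _) =>
      lazymatch g with
      | (fun _ => ?a) => apply: lin_sweedler | _ => apply: lin_sweedler_arg
      end; lin
  | |- GRing.linear_for _ (@tens _ _ _ _) => exact: tens_linearr
  | |- GRing.linear_for _ (@kmul _ _ _) => exact: kmul_linearr
  | |- GRing.linear_for _ (@ract _ _ _ _) => exact: ract_linearr
  | |- GRing.linear_for _ (fun z => @GRing.Linear.sort _ _ _ _ ?f (@?g z)) =>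
      apply: (@lin_comp _ _ _ _ f g); lin
  | |- GRing.linear_for _ (@GRing.Linear.sort _ _ _ _ ?f) => exact: (linearP f)
  | |- GRing.linear_for _ (fun z => _) =>
      first [ apply: lin_comp; lin | solve [auto] ]
  | _ => first [ exact: linearP | solve [auto] | apply: lin_comp; lin ]
  end.

Section CoassociativityRules.
Variable k : comPzRingType.

Lemma comulA_lin (C : coalgType k) (P : lmodType k) (f : C -> C -> C -> P) c :
  (forall y z, linear (fun x => f x y z)) ->
  (forall x z, linear (fun y => f x y z)) ->
  (forall x y, linear (fun z => f x y z)) ->
  \sw_(c1, c2 <- comul c) \sw_(c3, c4 <- comul c2) f c1 c3 c4
    = \sw_(c1, c2 <- comul c) \sw_(c3, c4 <- comul c1) f c3 c4 c2.
Proof.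
move=> f1 f2 f3.
pose g t := \sw_(x, u <- t) \sw_(y, z <- u) f x y z.
have gP : bilin (fun (x : C) (u : C ⊗ C) => \sw_(y, z <- u) f x y z) by lin.
have gl : linear g by exact: sweedler_linear.
have := congr1 g (comulA c); rewrite !(sweedler_lin _ _ gl) => e.
transitivity (\sw_(c1, c2 <- comul c) g (c1 ⊗ comul c2)).
  by apply: eq_sweedler => x y; rewrite /g sweedler_tens.
rewrite e; apply: eq_sweedler => x y; rewrite (sweedler_lin _ _ gl).
by apply: eq_sweedler => u v; rewrite /g !sweedler_tens.
Qed.

Lemma lcoactA_lin (C : coalgType k) (M : lcomodType C) (P : lmodType k)
    (f : C -> C -> M -> P) m :
  (forall y z, linear (fun x => f x y z)) ->
  (forall x z, linear (fun y => f x y z)) ->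
  (forall x y, linear (fun z => f x y z)) ->
  \sw_(c, n <- lcoact m) \sw_(d, p <- lcoact n) f c d p
    = \sw_(c, n <- lcoact m) \sw_(c1, c2 <- comul c) f c1 c2 n.
Proof.
move=> f1 f2 f3.
pose g t := \sw_(x, u <- t) \sw_(y, z <- u) f x y z.
have gP : bilin (fun (x : C) (u : C ⊗ M) => \sw_(y, z <- u) f x y z) by lin.
have gl : linear g by exact: sweedler_linear.
have := congr1 g (lcoactA m); rewrite !(sweedler_lin _ _ gl) => e.
transitivity (\sw_(c, n <- lcoact m) g (c ⊗ lcoact n)).
  by apply: eq_sweedler => x y; rewrite /g sweedler_tens.
rewrite e; apply: eq_sweedler => x y; rewrite (sweedler_lin _ _ gl).
by apply: eq_sweedler => u v; rewrite /g !sweedler_tens.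
Qed.

End CoassociativityRules.

Lemma counit_lin (k : comPzRingType) (C : coalgType k)
    (P : lmodType k) (f : C -> P) (c : C) : linear f ->
  \sw_(c1, c2 <- comul c) (counit c1 *: f c2) = f c
  /\ \sw_(c1, c2 <- comul c) (counit c2 *: f c1) = f c.
Proof.
move=> fP; split; [rewrite -[in RHS](counitl c) | rewrite -[in RHS](counitr c)];
  by rewrite (sweedler_lin _ _ fP); apply: eq_sweedler => x y; rewrite linZ.
Qed.

Section FreeComodule.
Variables (k : comPzRingType) (C : coalgType k) (M : lmodType k).

Definition free_lcoact (t : C ⊗ M) : C ⊗ (C ⊗ M) :=
  \sw_(c, m <- t) \sw_(c1, c2 <- comul c) (c1 ⊗ (c2 ⊗ m)).

Fact free_lcoact_linear : linear free_lcoact.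
Proof. by apply: sweedler_linear; lin. Qed.

HB.instance Definition _ := GRing.isLinear.Build k (C ⊗ M)%type
  (C ⊗ (C ⊗ M))%type *:%R free_lcoact free_lcoact_linear.

Lemma free_lcoactE c m :
  free_lcoact (c ⊗ m) = \sw_(c1, c2 <- comul c) (c1 ⊗ (c2 ⊗ m)).
Proof. by rewrite /free_lcoact sweedler_tens //; lin. Qed.

Fact free_lcoactA t :
  \sw_(c, n <- free_lcoact t) (c ⊗ free_lcoact n)
    = \sw_(c, n <- free_lcoact t) \sw_(c1, c2 <- comul c) (c1 ⊗ (c2 ⊗ n)).
Proof.
move: t; apply: tensor_ext; try lin.
move=> c m; rewrite free_lcoactE !sweedler_sweedler; try lin.
transitivity (\sw_(c1, c2 <- comul c) \sw_(c3, c4 <- comul c2)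
                (c1 ⊗ (c3 ⊗ (c4 ⊗ m)))).
  apply: eq_sweedler => x y; rewrite sweedler_tens; last by lin.
  rewrite free_lcoactE.
  by apply: (@sweedler_lin _ _ _ _ _ (fun t => x ⊗ t)); lin.
rewrite comulA_lin; try lin.
by apply: eq_sweedler => x y; rewrite sweedler_tens; last by lin.
Qed.

Fact free_lcoact_counit t : \sw_(c, n <- free_lcoact t) (counit c *: n) = t.
Proof.
move: t; apply: tensor_ext; try lin.
move=> c m; rewrite free_lcoactE !sweedler_sweedler; try lin.
transitivity (\sw_(c1, c2 <- comul c) (counit c1 *: (c2 ⊗ m))).
  by apply: eq_sweedler => x y; rewrite sweedler_tens; last by lin.
by apply: (counit_lin (f := fun z => z ⊗ m) _ _).1; lin.
Qed.

HB.instance Definition _ := Lmodule_isLComodule.Build k C (C ⊗ M)%type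
  free_lcoactA free_lcoact_counit.

End FreeComodule.

Section FreeDoiKoppinen.
Variables (k : comPzRingType) (H : hopfType k).
Variables (A : comodAlgType H) (C : modCoalgType H) (M : rmoduleType A).

Definition free_ract (t : C ⊗ M) (a : A) : C ⊗ M :=
  \sw_(c, m <- t) \sw_(h, a0 <- lcoact a) ((c ∙ h) ⊗ (m ∙ a0)).

Fact free_ract_linearl a : linear (free_ract^~ a).
Proof. by apply: sweedler_linear; lin. Qed.

Fact free_ract_linearr t : linear (free_ract t).
Proof. by rewrite /free_ract; lin. Qed.

Lemma free_ractE c m a :
  free_ract (c ⊗ m) a = \sw_(h, a0 <- lcoact a) ((c ∙ h) ⊗ (m ∙ a0)).
Proof. by rewrite /free_ract sweedler_tens //; lin. Qed.

Fact free_ractA t a b : free_ract t (a ⋆ b) = free_ract (free_ract t a) b.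
Proof.
have l1 a' := free_ract_linearl a'.
move: t; apply: tensor_ext => [||c m]; first by lin.
  by move=> c x y; rewrite !l1.
rewrite !free_ractE lcoactM (sweedler_lin _ _ (l1 b)).
rewrite sweedler_sweedler; last by lin.
apply: eq_sweedler => h a0; rewrite free_ractE sweedler_sweedler; last by lin.
apply: eq_sweedler => h' b0; rewrite sweedler_tens; last by lin.
by rewrite !ractA.
Qed.

Fact free_ract1 t : free_ract t kone = t.
Proof.
have l1 a' := free_ract_linearl a'.
move: t; apply: tensor_ext => [||c m]; try lin.
rewrite free_ractE lcoact1 sweedler_tens; last by lin.
by rewrite !ract1.
Qed.

HB.instance Definition _ := Lmodule_isRModule.Build k A (C ⊗ M)%type
  free_ract_linearl free_ract_linearr free_ractA free_ract1.

Fact free_lcoact_ract (t : C ⊗ M) (a : A) : lcoact (t ∙ a)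
  = \sw_(c, n <- lcoact t) \sw_(h, a0 <- lcoact a) ((c ∙ h) ⊗ (n ∙ a0)).
Proof.
move: t; apply: tensor_ext; try lin.
move=> c m; rewrite [in LHS]/ract /= free_ractE.
rewrite (sweedler_lin _ _ (@free_lcoact_linear _ C M)).
rewrite [lcoact (c ⊗ m)]free_lcoactE sweedler_sweedler; last by lin.
transitivity (\sw_(h, a0 <- lcoact a) \sw_(c1, c2 <- comul c)
   \sw_(h1, h2 <- comul h) ((c1 ∙ h1) ⊗ ((c2 ∙ h2) ⊗ (m ∙ a0)))).
  apply: eq_sweedler => h a0; rewrite free_lcoactE comul_ract.
  rewrite sweedler_sweedler; last by lin.
  apply: eq_sweedler => c1 c2; rewrite sweedler_sweedler; last by lin.
  by apply: eq_sweedler => h1 h2; rewrite sweedler_tens //; lin.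
rewrite exchange_sweedler; apply: eq_sweedler => c1 c2.
rewrite sweedler_tens; last by lin.
rewrite -(lcoactA_lin
  (f := fun h1 h2 a0 => (c1 ∙ h1) ⊗ ((c2 ∙ h2) ⊗ (m ∙ a0)))); try lin.
apply: eq_sweedler => h a0; rewrite [(c2 ⊗ m) ∙ a0]free_ractE.
by rewrite (sweedler_lin _ _ (g := fun t => (c1 ∙ h) ⊗ t)) //; lin.
Qed.

HB.instance Definition _ := RModule_LComodule_isDoiKoppinen.Build k H A C
  (C ⊗ M)%type free_lcoact_ract.

End FreeDoiKoppinen.

Section AntipodeComul.
Variables (k : comPzRingType) (H : hopfType k).

Let mm (x y : H ⊗ H) : H ⊗ H :=
  \sw_(a, b <- x) \sw_(c, d <- y) ((a ⋆ c) ⊗ (b ⋆ d)).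

Let mm_linl y : linear (mm^~ y). Proof. by rewrite /mm; lin. Qed.
Let mm_linr x : linear (mm x). Proof. by rewrite /mm; lin. Qed.

Let mmE a b c d : mm (a ⊗ b) (c ⊗ d) = (a ⋆ c) ⊗ (b ⋆ d).
Proof. by rewrite /mm sweedler_tens ?sweedler_tens //; lin. Qed.

Let mmA x y z : mm x (mm y z) = mm (mm x y) z.
Proof.
move: x; apply: tensor_ext => [||a b].
- exact: mm_linl.
- by move=> e u v; rewrite !mm_linl.
move: y; apply: tensor_ext => [||c d].
- by move=> e u v; rewrite mm_linl mm_linr.
- by move=> e u v; rewrite mm_linr mm_linl.
move: z; apply: tensor_ext => [||e f].
- by move=> g u v; rewrite !mm_linr.
- exact: mm_linr.
by rewrite !mmE !kmulA.
Qed.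

Let one2 : H ⊗ H := kone ⊗ kone.
Let mm1l x : mm one2 x = x.
Proof.
move: x; apply: tensor_ext => [||a b].
- exact: mm_linr.
- by [].
by rewrite mmE !kmul1l.
Qed.
Let mm1r x : mm x one2 = x.
Proof.
move: x; apply: tensor_ext => [||a b].
- exact: mm_linl.
- by [].
by rewrite mmE !kmul1r.
Qed.

Let R (h : H) : H ⊗ H := \sw_(h1, h2 <- comul h) (antipode h2 ⊗ antipode h1).
Let R_lin : linear R. Proof. by rewrite /R; lin. Qed.

Let left_inv h :
  \sw_(h1, h2 <- comul h) mm (comul (antipode h1)) (comul h2) = counit h *: one2.
Proof.
rewrite /one2 -comul1 -linearZ /= -antipodel.
rewrite (sweedler_lin _ _ (g := fun z => comul z)); last by lin.
by apply: eq_sweedler => a b; rewrite comulM.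
Qed.

Let right_inv h :
  \sw_(h1, h2 <- comul h) mm (comul h1) (R h2) = counit h *: one2.
Proof.
have e1 : forall a b : H, mm (comul a) (R b) =
    \sw_(a1, a2 <- comul a) \sw_(b1, b2 <- comul b)
       ((a1 ⋆ antipode b2) ⊗ (a2 ⋆ antipode b1)).
  move=> a b; rewrite /R (sweedler_lin _ _ (mm_linr _)) /mm exchange_sweedler.
  apply: eq_sweedler => b1 b2; apply: eq_sweedler => a1 a2.
  by rewrite sweedler_tens //; lin.
rewrite (eq_sweedler _ e1).
(* h1 S(h4) ⊗ h2 S(h3) *)
rewrite -(comulA_lin (f := fun x y z => \sw_(b1, b2 <- comul z)
   ((x ⋆ antipode b2) ⊗ (y ⋆ antipode b1)))); try lin.
transitivity (\sw_(x, w <- comul h) ((x ⋆ antipode w) ⊗ (kone : H))).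
  apply: eq_sweedler => x w.
  rewrite (comulA_lin
    (f := fun y z t => (x ⋆ antipode t) ⊗ (y ⋆ antipode z))); try lin.
  transitivity (\sw_(y, t <- comul w)
      (counit y *: ((x ⋆ antipode t) ⊗ (kone : H)))).
    apply: eq_sweedler => y t.
    rewrite -(sweedler_lin _ _ (g := fun u => (x ⋆ antipode t) ⊗ u)); last by lin.
    by rewrite antipoder tensZr.
  by apply: (counit_lin (f := fun z => (x ⋆ antipode z) ⊗ (kone : H)) _ _).1; lin.
rewrite -(sweedler_lin _ _ (g := fun u => u ⊗ (kone : H))); last by lin.
by rewrite antipoder /one2 tensZl.
Qed.

Lemma comul_antipode (h : H) : comul (antipode h)
  = \sw_(h1, h2 <- comul h) (antipode h2 ⊗ antipode h1).
Proof.
have lL : linear (fun z : H => comul (antipode z)) by lin.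
rewrite -(counit_lin h lL).2 -[RHS](counit_lin h R_lin).1.
transitivity (\sw_(h1, h2 <- comul h) \sw_(a, b <- comul h2)
    mm (comul (antipode h1)) (mm (comul a) (R b))).
  apply: eq_sweedler => h1 h2.
  rewrite -(sweedler_lin _ _ (mm_linr _)) right_inv (linZ _ _ (mm_linr _)).
  by rewrite mm1r.
rewrite (comulA_lin (f := fun x a b =>
  mm (comul (antipode x)) (mm (comul a) (R b)))).
- apply: eq_sweedler => h1 h2.
  transitivity (\sw_(a, b <- comul h1)
      mm (mm (comul (antipode a)) (comul b)) (R h2)).
    by apply: eq_sweedler => a b; rewrite mmA.
  rewrite -(sweedler_lin _ _ (mm_linl _)) left_inv (linZ _ _ (mm_linl _)).
  by rewrite mm1l.
- by move=> y z a u v; rewrite !linearP mm_linl.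
- by move=> x z a u v; rewrite linearP mm_linl mm_linr.
- by move=> x y a u v; rewrite R_lin !mm_linr.
Qed.

End AntipodeComul.

Section Bicomodules.
Variables (k : comPzRingType) (H : hopfType k).
Variables (A : comodAlgType H) (C : modCoalgType H).

Definition rcoactCA (t : C ⊗ A) : (C ⊗ A) ⊗ C :=
  \sw_(c, a <- t) \sw_(c1, c2 <- comul c) \sw_(h, a0 <- lcoact a)
    ((c1 ⊗ a0) ⊗ (c2 ∙ antipode h)).

Fact rcoactCA_linear : linear rcoactCA.
Proof. by apply: sweedler_linear; lin. Qed.

HB.instance Definition _ := GRing.isLinear.Build k (C ⊗ A)%type
  ((C ⊗ A) ⊗ C)%type *:%R rcoactCA rcoactCA_linear.

Lemma rcoactCAE (c : C) (a : A) : rcoactCA (c ⊗ a) =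
  \sw_(c1, c2 <- comul c) \sw_(h, a0 <- lcoact a)
    ((c1 ⊗ a0) ⊗ (c2 ∙ antipode h)).
Proof. by rewrite /rcoactCA sweedler_tens //; lin. Qed.

Fact rcoactCAA t :
  \sw_(n, c <- rcoactCA t) \sw_(n', c' <- rcoactCA n) (n' ⊗ (c' ⊗ c))
    = \sw_(n, c <- rcoactCA t) (n ⊗ comul c).
Proof.
move: t; apply: tensor_ext => [||c a]; try lin.
rewrite rcoactCAE !sweedler_sweedler; try lin.
(* c1 ⊗ a0 ⊗ c2 S(a-1) ⊗ c3 S(a-2) *)
transitivity (\sw_(c1, c3 <- comul c) \sw_(c11, c12 <- comul c1)
   \sw_(h, a0 <- lcoact a) \sw_(h', a1 <- lcoact a0)
   ((c11 ⊗ a1) ⊗ ((c12 ∙ antipode h') ⊗ (c3 ∙ antipode h)))).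
  apply: eq_sweedler => c1 c3; rewrite sweedler_sweedler; last by lin.
  rewrite exchange_sweedler; apply: eq_sweedler => h a0.
  rewrite sweedler_tens; last by lin.
  rewrite rcoactCAE sweedler_sweedler; last by lin.
  apply: eq_sweedler => c11 c12; rewrite sweedler_sweedler; last by lin.
  by apply: eq_sweedler => h' a1; rewrite sweedler_tens //; lin.
rewrite -(comulA_lin (f := fun c11 c12 c3 => \sw_(h, a0 <- lcoact a)
   \sw_(h', a1 <- lcoact a0)
   ((c11 ⊗ a1) ⊗ ((c12 ∙ antipode h') ⊗ (c3 ∙ antipode h))))); try lin.
apply: eq_sweedler => c1 c2.
transitivity (\sw_(d, d' <- comul c2) \sw_(h, a0 <- lcoact a)
   \sw_(h1, h2 <- comul h)
   ((c1 ⊗ a0) ⊗ ((d ∙ antipode h2) ⊗ (d' ∙ antipode h1)))).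
  apply: eq_sweedler => d d'.
  by rewrite (lcoactA_lin (f := fun h h' a1 =>
    ((c1 ⊗ a1) ⊗ ((d ∙ antipode h') ⊗ (d' ∙ antipode h))))); try lin.
rewrite exchange_sweedler sweedler_sweedler; last by lin.
apply: eq_sweedler => h a0; rewrite sweedler_tens; last by lin.
rewrite comul_ract comul_antipode.
rewrite (sweedler_lin _ _ (@tens_linearr _ _ _ _)).
apply: eq_sweedler => d d'; rewrite sweedler_sweedler; last by lin.
rewrite (sweedler_lin _ _ (@tens_linearr _ _ _ _)).
by apply: eq_sweedler => h1 h2; rewrite sweedler_tens //; lin.
Qed.

Fact rcoactCA_counit t : \sw_(n, c <- rcoactCA t) (counit c *: n) = t.
Proof.
move: t; apply: tensor_ext => [||c a]; try lin.
rewrite rcoactCAE sweedler_sweedler; last by lin.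
transitivity (\sw_(c1, c2 <- comul c) (counit c2 *: (c1 ⊗ a))).
  apply: eq_sweedler => c1 c2; rewrite sweedler_sweedler; last by lin.
  transitivity (\sw_(h, a0 <- lcoact a)
      (counit c2 *: (c1 ⊗ (counit h *: a0)))).
    apply: eq_sweedler => h a0; rewrite sweedler_tens; last by lin.
    by rewrite counit_ract counit_antipode tensZr scalerA.
  rewrite -(sweedler_lin _ _ (g := fun b => counit c2 *: (c1 ⊗ b))); last by lin.
  by rewrite lcoact_counit.
by apply: (counit_lin (f := fun z => (z ⊗ a)) _ _).2; lin.
Qed.

Fact lrcoactCAA (t : C ⊗ A) :
  \sw_(n, d <- rcoactCA t) \sw_(c, p <- lcoact n) (c ⊗ (p ⊗ d))
    = \sw_(c, n <- lcoact t) (c ⊗ rcoactCA n).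
Proof.
move: t; apply: tensor_ext => [||c a]; try lin.
rewrite rcoactCAE [lcoact (_ ⊗ _)]free_lcoactE !sweedler_sweedler; try lin.
transitivity (\sw_(c1, c3 <- comul c) \sw_(c11, c12 <- comul c1)
   \sw_(h, a0 <- lcoact a)
   (c11 ⊗ ((c12 ⊗ a0) ⊗ (c3 ∙ antipode h)))).
  apply: eq_sweedler => c1 c3; rewrite sweedler_sweedler; last by lin.
  rewrite exchange_sweedler; apply: eq_sweedler => h a0.
  rewrite sweedler_tens; last by lin.
  rewrite [lcoact _]free_lcoactE sweedler_sweedler; last by lin.
  by apply: eq_sweedler => c11 c12; rewrite sweedler_tens //; lin.
rewrite -(comulA_lin (f := fun c11 c12 c3 => \sw_(h, a0 <- lcoact a)
   (c11 ⊗ ((c12 ⊗ a0) ⊗ (c3 ∙ antipode h))))); try lin.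
apply: eq_sweedler => c1 c2; rewrite sweedler_tens; last by lin.
rewrite rcoactCAE (sweedler_lin _ _ (@tens_linearr _ _ _ _)).
by apply: eq_sweedler => d d'; rewrite (sweedler_lin _ _ (@tens_linearr _ _ _ _)).
Qed.

Definition rcoactCCA (t : C ⊗ (C ⊗ A)) : (C ⊗ (C ⊗ A)) ⊗ C :=
  \sw_(c, u <- t) \sw_(d, b <- u)
    \sw_(d1, d2 <- comul d) \sw_(h, b0 <- lcoact b)
      ((c ⊗ (d1 ⊗ b0)) ⊗ (d2 ∙ antipode h)).

Fact rcoactCCA_linear : linear rcoactCCA.
Proof. by apply: sweedler_linear; lin. Qed.

HB.instance Definition _ := GRing.isLinear.Build k (C ⊗ (C ⊗ A))%type
  ((C ⊗ (C ⊗ A)) ⊗ C)%type *:%R rcoactCCA rcoactCCA_linear.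

Lemma rcoactCCA_tens (c : C) (u : C ⊗ A) : rcoactCCA (c ⊗ u) =
  \sw_(v, d <- rcoactCA u) ((c ⊗ v) ⊗ d).
Proof.
rewrite /rcoactCCA sweedler_tens; last by lin.
rewrite /rcoactCA sweedler_sweedler; last by lin.
apply: eq_sweedler => d b; rewrite sweedler_sweedler; last by lin.
apply: eq_sweedler => d1 d2; rewrite sweedler_sweedler; last by lin.
by apply: eq_sweedler => h b0; rewrite sweedler_tens //; lin.
Qed.

Fact rcoactCCAA t :
  \sw_(n, c <- rcoactCCA t) \sw_(n', c' <- rcoactCCA n) (n' ⊗ (c' ⊗ c))
    = \sw_(n, c <- rcoactCCA t) (n ⊗ comul c).
Proof.
move: t; apply: tensor_ext => [||c u]; try lin.
rewrite rcoactCCA_tens [LHS]sweedler_sweedler; last by lin.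
rewrite [RHS]sweedler_sweedler; last by lin.
pose g (w : (C ⊗ A) ⊗ (C ⊗ C)) : (C ⊗ (C ⊗ A)) ⊗ (C ⊗ C) :=
  \sw_(v, e <- w) ((c ⊗ v) ⊗ e).
have gl : linear g by apply: sweedler_linear; lin.
have gE v e : g (v ⊗ e) = (c ⊗ v) ⊗ e.
  by rewrite /g sweedler_tens //; lin.
have := congr1 g (rcoactCAA u); rewrite !(sweedler_lin _ _ gl) => e.
transitivity (\sw_(n, d <- rcoactCA u)
    g (\sw_(n', d' <- rcoactCA n) (n' ⊗ (d' ⊗ d)))).
  apply: eq_sweedler => v d; rewrite sweedler_tens; last by lin.
  rewrite rcoactCCA_tens sweedler_sweedler; last by lin.
  rewrite (sweedler_lin _ _ gl); apply: eq_sweedler => v' d'.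
  by rewrite gE sweedler_tens //; lin.
rewrite e; apply: eq_sweedler => v d.
by rewrite gE sweedler_tens //; lin.
Qed.

Fact rcoactCCA_counit t : \sw_(n, c <- rcoactCCA t) (counit c *: n) = t.
Proof.
move: t; apply: tensor_ext => [||c u]; try lin.
rewrite rcoactCCA_tens sweedler_sweedler; last by lin.
rewrite -[in RHS](rcoactCA_counit u).
rewrite (sweedler_lin _ _ (g := fun v => (c ⊗ v))); last by lin.
apply: eq_sweedler => v d; rewrite sweedler_tens; last by lin.
by rewrite tensZr.
Qed.

Fact lrcoactCCAA (t : C ⊗ (C ⊗ A)) :
  \sw_(n, d <- rcoactCCA t) \sw_(c, p <- lcoact n) (c ⊗ (p ⊗ d))
    = \sw_(c, n <- lcoact t) (c ⊗ rcoactCCA n).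
Proof.
move: t; apply: tensor_ext => [||c u]; try lin.
rewrite rcoactCCA_tens [lcoact (_ ⊗ _)]free_lcoactE.
rewrite [LHS]sweedler_sweedler; last by lin.
rewrite [RHS]sweedler_sweedler; last by lin.
transitivity (\sw_(v, d <- rcoactCA u) \sw_(c1, c2 <- comul c)
   (c1 ⊗ ((c2 ⊗ v) ⊗ d))).
  apply: eq_sweedler => v d; rewrite sweedler_tens; last by lin.
  rewrite [lcoact _]free_lcoactE sweedler_sweedler; last by lin.
  by apply: eq_sweedler => c1 c2; rewrite sweedler_tens //; lin.
rewrite exchange_sweedler; apply: eq_sweedler => c1 c2.
rewrite sweedler_tens; last by lin.
by rewrite rcoactCCA_tens (sweedler_lin _ _ (@tens_linearr _ _ _ _)).
Qed.

Definition rcomodCA : rcomodType C := HB.pack (C ⊗ A)%type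
  (Lmodule_isRComodule.Build k C (C ⊗ A)%type rcoactCAA rcoactCA_counit).
Definition rcomodCCA : rcomodType C := HB.pack (C ⊗ (C ⊗ A))%type
  (Lmodule_isRComodule.Build k C (C ⊗ (C ⊗ A))%type
     rcoactCCAA rcoactCCA_counit).

Definition bicomodCA : bicomodType C := HB.pack (C ⊗ A)%type rcomodCA
  (LRComodule_isBicomodule.Build k C rcomodCA lrcoactCAA).
Definition bicomodCCA : bicomodType C := HB.pack (C ⊗ (C ⊗ A))%type rcomodCCA
  (LRComodule_isBicomodule.Build k C rcomodCCA lrcoactCCAA).

End Bicomodules.
Arguments bicomodCA {k H} A C.
Arguments bicomodCCA {k H} A C.

Section CoactionFormulas.
Variables (k : comPzRingType) (H : hopfType k).
Variables (A : comodAlgType H) (C : modCoalgType H).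

Lemma lcoact_tens (M : lmodType k) (c : C) (m : M) :
  lcoact (c ⊗ m) = \sw_(c1, c2 <- comul c) (c1 ⊗ (c2 ⊗ m)).
Proof. exact: free_lcoactE. Qed.

Lemma ract_tens (M : rmoduleType A) (c : C) (m : M) (a : A) :
  (c ⊗ m) ∙ a = \sw_(h, a0 <- lcoact a) ((c ∙ h) ⊗ (m ∙ a0)).
Proof. exact: free_ractE. Qed.

Lemma lcoact_bicomodCA (c : C) (a : A) :
  lcoact (c ⊗ a : bicomodCA A C) = \sw_(c1, c2 <- comul c) (c1 ⊗ (c2 ⊗ a)).
Proof. exact: free_lcoactE. Qed.

Lemma rcoact_bicomodCA (c : C) (a : A) :
  rcoact (c ⊗ a : bicomodCA A C) =
  \sw_(c1, c2 <- comul c) \sw_(h, a0 <- lcoact a)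
    ((c1 ⊗ a0) ⊗ (c2 ∙ antipode h)).
Proof. exact: rcoactCAE. Qed.

Lemma lcoact_bicomodCCA (c d : C) (b : A) :
  lcoact (c ⊗ (d ⊗ b) : bicomodCCA A C) =
  \sw_(c1, c2 <- comul c) (c1 ⊗ (c2 ⊗ (d ⊗ b))).
Proof. exact: free_lcoactE. Qed.

Lemma rcoact_bicomodCCA (c d : C) (b : A) :
  rcoact (c ⊗ (d ⊗ b) : bicomodCCA A C) =
  \sw_(d1, d2 <- comul d) \sw_(h, b0 <- lcoact b)
    ((c ⊗ (d1 ⊗ b0)) ⊗ (d2 ∙ antipode h)).
Proof.
transitivity (rcoactCCA (c ⊗ (d ⊗ b))); first by [].
by rewrite /rcoactCCA sweedler_tens ?sweedler_tens //; lin.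
Qed.

End CoactionFormulas.

Definition rlinear (k : comPzRingType) (A : kalgType k) (M N : rmoduleType A)
    (f : M -> N) : Prop :=
  forall (m : M) (a : A), f (m ∙ a) = f m ∙ a.

Definition lcolinear (k : comPzRingType) (C : coalgType k)
    (M N : lcomodType C) (f : M -> N) : Prop :=
  forall m : M, lcoact (f m) = \sw_(c, n <- lcoact m) (c ⊗ f n).

Definition rcolinear (k : comPzRingType) (C : coalgType k)
    (M N : rcomodType C) (f : M -> N) : Prop :=
  forall m : M, rcoact (f m) = \sw_(n, c <- rcoact m) (f n ⊗ c).

Definition relative_injective (k : comPzRingType) (C : coalgType k)
    (M : lcomodType C) : Prop :=
  forall (U V : lcomodType C) (i : {linear U -> V}) (f : {linear U -> M}),
    lcolinear i -> (exists p : {linear V -> U}, cancel i p) -> lcolinear f ->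
  exists g : {linear V -> M}, lcolinear g /\ forall u : U, g (i u) = f u.

Section Datum.
Variables (k : comPzRingType) (H : hopfType k).
Variables (A : comodAlgType H) (C : modCoalgType H).

(* bilin gamma says that gamma is a k-linear map from C to Hom(C, A). *)
Definition is_integral (gamma : C -> C -> A) : Prop :=
  bilin gamma /\
  forall c d : C,
    \sw_(c1, c2 <- comul c) (c1 ⊗ gamma c2 d)
      = \sw_(d1, d2 <- comul d) \sw_(h, a <- lcoact (gamma c d1))
          ((d2 ∙ h) ⊗ a).

Definition is_total (gamma : C -> C -> A) : Prop :=
  forall c : C, \sw_(c1, c2 <- comul c) gamma c1 c2 = counit c *: kone.

Definition forgetA (M : doiKoppinenType A C) : lcomodType C := M.
Definition forgetC (M : doiKoppinenType A C) : rmoduleType A := M.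
Definition cofree (M : rmoduleType A) : doiKoppinenType A C := (C ⊗ M)%type.

Definition cofree_map (M N : rmoduleType A) (f : M -> N)
    (t : cofree M) : cofree N :=
  \sw_(c, m <- t) (c ⊗ f m).

Definition nat_trans (lambda : forall M : doiKoppinenType A C,
    {linear forgetA (cofree (forgetC M)) -> forgetA M}) : Prop :=
  (forall M, lcolinear (lambda M)) /\
  (forall (M N : doiKoppinenType A C) (f : {linear M -> N}),
     rlinear f -> lcolinear f ->
     forall t : cofree (forgetC M),
       lambda N (@cofree_map (forgetC M) (forgetC N) f t) = f (lambda M t)).

Definition bicomod_map (M N : bicomodType C) (f : M -> N) : Prop :=
  lcolinear f /\ rcolinear f.

End Datum.

(* Main.v *)
Require Import Defs.
From HB Require Import structures.
From mathcomp Require Import all_boot all_order all_algebra.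

(* A total integral gamma gives the retractions
   lambda_M (c ⊗ m) = m_<0> gamma(c)(m_<-1>). Conversely, the right coaction
   C ⊗ A -> (C ⊗ A) ⊗ C is a morphism of Doi-Koppinen modules when A acts and
   C coacts on the left factor of (C ⊗ A) ⊗ C only, and so is each
   m |-> m ⊗ c; naturality of lambda with respect to these morphisms makes
   lambda_(C ⊗ A) a map of bicomodules. From a bicomodule retraction lambda,
   gamma(c)(d) = (counit ⊗ id) lambda (c ⊗ d ⊗ 1) is a total integral: both
   sides of the integral identity equal lambda (c ⊗ d ⊗ 1), one by left and
   the other by right colinearity. Finally, a colinear f : U -> M extends along
   a split i : U -> V, with k-linear retraction p, to
   v |-> lambda_M (v_<-1> ⊗ f (p v_<0>)). *)

Set Implicit Arguments.
Unset Strict Implicit.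
Unset Printing Implicit Defensive.

Import GRing.Theory.
Local Open Scope ring_scope.

(** * The antipode reverses products *)

Section Antipode.
Variables (k : comPzRingType) (H : hopfType k).

Lemma antipode1 : antipode (kone : H) = kone.
Proof.
have := antipodel (kone : H); rewrite comul1 sweedler_tens; last by lin.
by rewrite kmul1r counit1 scale1r.
Qed.

Let antipode_mull (g h : H) :
  \sw_(g1, g2 <- comul g) \sw_(h1, h2 <- comul h)
    (antipode (g1 ⋆ h1) ⋆ (g2 ⋆ h2)) = counit g *: (counit h *: kone).
Proof.
rewrite scalerA -counitM -antipodel comulM sweedler_sweedler; last by lin.
apply: eq_sweedler => g1 g2; rewrite sweedler_sweedler; last by lin.
by apply: eq_sweedler => h1 h2; rewrite sweedler_tens //; lin.
Qed.

Let mul_antipode (g h : H) :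
  \sw_(g1, g2 <- comul g) \sw_(h1, h2 <- comul h)
    ((g1 ⋆ h1) ⋆ (antipode h2 ⋆ antipode g2)) = counit g *: (counit h *: kone).
Proof.
(* In [g_(1) h_(1) S(h_(2)) S(g_(2))] the sum over [h] is innermost, so it collapses first. *)
transitivity (\sw_(g1, g2 <- comul g)
    (counit h *: (g1 ⋆ antipode g2))).
  apply: eq_sweedler => g1 g2.
  transitivity ((g1 ⋆ (\sw_(h1, h2 <- comul h) (h1 ⋆ antipode h2)))
      ⋆ antipode g2).
    rewrite (sweedler_lin _ _ (g := fun z => (g1 ⋆ z) ⋆ antipode g2)).
      by apply: eq_sweedler => h1 h2; rewrite !kmulA.
    by lin.
  rewrite antipoder (linZ _ _ (kmul_linearr _)) kmul1r.
  by rewrite (linZ _ _ (kmul_linearl _)).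
rewrite -scale_sweedler antipoder scalerA mulrC.
by rewrite scalerA.
Qed.

(* [S(gh)] and [S(h)S(g)] are a left and a right convolution inverse of the
   multiplication [H ⊗ H -> H]. *)
Lemma antipodeM (g h : H) : antipode (g ⋆ h) = antipode h ⋆ antipode g.
Proof.
pose F (g1 a b h1 c d : H) :=
  antipode (g1 ⋆ h1) ⋆ ((a ⋆ c) ⋆ (antipode d ⋆ antipode b)).
(* Both sides are evaluations of the sum of [S(g_(1) h_(1)) g_(2) h_(2) S(h_(3)) S(g_(3))]. Here the
   last four factors collapse by [mul_antipode]. *)
transitivity (\sw_(g1, g2 <- comul g) \sw_(h1, h2 <- comul h)
   \sw_(a, b <- comul g2) \sw_(c, d <- comul h2) F g1 a b h1 c d).
  transitivity (\sw_(g1, g2 <- comul g) (counit g2 *: antipode (g1 ⋆ h))).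
    by rewrite (counit_lin (f := fun z => antipode (z ⋆ h)) g _).2 //; lin.
  apply: eq_sweedler => g1 g2.
  rewrite -(counit_lin (f := fun z => antipode (g1 ⋆ z)) h _).2; last by lin.
  rewrite scale_sweedler; apply: eq_sweedler => h1 h2; rewrite /F.
  pose m z := antipode (g1 ⋆ h1) ⋆ z.
  have ml : linear m by rewrite /m; lin.
  transitivity (m (counit g2 *: (counit h2 *: kone))).
    by rewrite !(linZ _ _ ml) /m kmul1r.
  rewrite -mul_antipode (sweedler_lin _ _ ml); apply: eq_sweedler => a b.
  by rewrite (sweedler_lin _ _ ml).
(* Coassociativity in [g] and in [h] regroups the sum so that [antipode_mull] applies to the leading
   factors. *)
transitivity (\sw_(g1, g2 <- comul g) \sw_(a, b <- comul g1)
   \sw_(h1, h2 <- comul h) \sw_(c, d <- comul h1) F a b g2 c d h2).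
  transitivity (\sw_(g1, g2 <- comul g) \sw_(a, b <- comul g2)
     \sw_(h1, h2 <- comul h) \sw_(c, d <- comul h2) F g1 a b h1 c d).
    by apply: eq_sweedler => g1 g2; rewrite exchange_sweedler.
  rewrite (comulA_lin (f := fun g1 a b =>
    \sw_(h1, h2 <- comul h) \sw_(c, d <- comul h2) F g1 a b h1 c d));
    rewrite /F; try lin.
  apply: eq_sweedler => g1 g2; apply: eq_sweedler => a b.
  by rewrite comulA_lin //; lin.
transitivity (\sw_(g1, g2 <- comul g) (counit g1 *: (antipode h ⋆ antipode g2))).
  apply: eq_sweedler => g1 g2; rewrite exchange_sweedler.
  rewrite -(counit_lin (f := fun z => antipode z ⋆ antipode g2) h _).1; last by lin.
  rewrite scale_sweedler; apply: eq_sweedler => h1 h2; rewrite /F.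
  pose m z := z ⋆ (antipode h2 ⋆ antipode g2).
  have ml : linear m by rewrite /m; lin.
  transitivity (m (counit g1 *: (counit h1 *: kone))); last first.
    by rewrite !(linZ _ _ ml) /m kmul1l.
  rewrite -antipode_mull (sweedler_lin _ _ ml); apply: eq_sweedler => a b.
  rewrite (sweedler_lin _ _ ml); apply: eq_sweedler => c d.
  by rewrite /m !kmulA.
by rewrite (counit_lin (f := fun z => antipode h ⋆ antipode z) g _).1 //; lin.
Qed.

End Antipode.

Section RegularModule.
Variables (k : comPzRingType) (A : kalgType k).

(** It turns [C ⊗ A] into a cofree Doi-Koppinen module, the one at which a natural splitting becomes
    a map of bicomodules. *)
Definition regular_module : rmoduleType A := HB.pack (KAlgebra.sort A)
  (Lmodule_isRModule.Build k A A (@kmul_linearl k A) (@kmul_linearr k A)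
     (@kmulA k A) (@kmul1r k A)).

End RegularModule.

(** * Doi-Koppinen modules [M ⊗ V] with both structures on the left factor *)

Section TensorModule.
Variables (k : comPzRingType) (H : hopfType k).
Variables (A : comodAlgType H) (C : modCoalgType H).
Variables (M : doiKoppinenType A C) (V : lmodType k).

Definition tensor_lcoact (t : M ⊗ V) : C ⊗ (M ⊗ V) :=
  \sw_(m, v <- t) \sw_(c, m0 <- lcoact m) (c ⊗ (m0 ⊗ v)).

Fact tensor_lcoact_linear : linear tensor_lcoact.
Proof. by apply: sweedler_linear; lin. Qed.

HB.instance Definition _ := GRing.isLinear.Build k (M ⊗ V)%type
  (C ⊗ (M ⊗ V))%type *:%R tensor_lcoact tensor_lcoact_linear.

Lemma tensor_lcoactE m v :
  tensor_lcoact (m ⊗ v) = \sw_(c, m0 <- lcoact m) (c ⊗ (m0 ⊗ v)).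
Proof. by rewrite /tensor_lcoact sweedler_tens //; lin. Qed.

Fact tensor_lcoactA t :
  \sw_(c, n <- tensor_lcoact t) (c ⊗ tensor_lcoact n)
    = \sw_(c, n <- tensor_lcoact t) \sw_(c1, c2 <- comul c) (c1 ⊗ (c2 ⊗ n)).
Proof.
move: t; apply: tensor_ext => [||m v]; try lin.
rewrite tensor_lcoactE !sweedler_sweedler; try lin.
transitivity (\sw_(c, n <- lcoact m) \sw_(d, p <- lcoact n)
    (c ⊗ (d ⊗ (p ⊗ v)))).
  apply: eq_sweedler => c n; rewrite sweedler_tens; last by lin.
  by rewrite tensor_lcoactE (sweedler_lin _ _ (@tens_linearr _ _ _ _)).
rewrite (lcoactA_lin (f := fun c d p => c ⊗ (d ⊗ (p ⊗ v)))); try lin.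
by apply: eq_sweedler => c n; rewrite sweedler_tens //; lin.
Qed.

Fact tensor_lcoact_counit t :
  \sw_(c, n <- tensor_lcoact t) (counit c *: n) = t.
Proof.
move: t; apply: tensor_ext => [||m v]; try lin.
rewrite tensor_lcoactE sweedler_sweedler; last by lin.
rewrite -[in RHS](lcoact_counit m).
rewrite (sweedler_lin _ _ (@tens_linearl _ _ _ _)).
apply: eq_sweedler => c n; rewrite sweedler_tens; last by lin.
by rewrite tensZl.
Qed.

Definition tensor_ract (t : M ⊗ V) (a : A) : M ⊗ V :=
  \sw_(m, v <- t) ((m ∙ a) ⊗ v).

Fact tensor_ract_linearl a : linear (tensor_ract^~ a).
Proof. by apply: sweedler_linear; lin. Qed.

Fact tensor_ract_linearr t : linear (tensor_ract t).
Proof. by rewrite /tensor_ract; lin. Qed.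

Lemma tensor_ractE m v a : tensor_ract (m ⊗ v) a = (m ∙ a) ⊗ v.
Proof. by rewrite /tensor_ract sweedler_tens //; lin. Qed.

Fact tensor_ractA t a b :
  tensor_ract t (a ⋆ b) = tensor_ract (tensor_ract t a) b.
Proof.
have l c := tensor_ract_linearl c.
move: t; apply: tensor_ext => [||m v]; first by lin.
  by move=> c x y; rewrite !l.
by rewrite !tensor_ractE ractA.
Qed.

Fact tensor_ract1 t : tensor_ract t kone = t.
Proof.
have l c := tensor_ract_linearl c.
by move: t; apply: tensor_ext => [||m v]; try lin; rewrite tensor_ractE ract1.
Qed.

Fact tensor_lcoact_ract t a : tensor_lcoact (tensor_ract t a)
  = \sw_(c, n <- tensor_lcoact t) \sw_(h, a0 <- lcoact a)
      ((c ∙ h) ⊗ tensor_ract n a0).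
Proof.
have l c := tensor_ract_linearl c.
have r n := tensor_ract_linearr n.
move: t; apply: tensor_ext => [||m v]; try lin.
rewrite tensor_ractE !tensor_lcoactE lcoact_ract !sweedler_sweedler; try lin.
apply: eq_sweedler => c m0; rewrite sweedler_sweedler; last by lin.
rewrite sweedler_tens; last by lin.
apply: eq_sweedler => h a0; rewrite sweedler_tens; last by lin.
by rewrite tensor_ractE.
Qed.

(** A separate name keeps these structures apart from the cofree ones already attached to tensor
    products whose left factor is [C]. *)
Definition tensor_dk : Type := (M ⊗ V)%type.
HB.instance Definition _ := GRing.Lmodule.on tensor_dk.
HB.instance Definition _ := Lmodule_isLComodule.Build k C tensor_dk
  tensor_lcoactA tensor_lcoact_counit.
HB.instance Definition _ := Lmodule_isRModule.Build k A tensor_dk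
  tensor_ract_linearl tensor_ract_linearr tensor_ractA tensor_ract1.
HB.instance Definition _ := RModule_LComodule_isDoiKoppinen.Build k H A C
  tensor_dk tensor_lcoact_ract.

End TensorModule.

Section Datum.
Variables (k : comPzRingType) (H : hopfType k).
Variables (A : comodAlgType H) (C : modCoalgType H).

(** * From a total integral to natural retractions *)

Section IntegralToSplitting.
Variable gamma : C -> C -> A.
Hypothesis gammaP : is_integral gamma.

Let gammal d : linear (gamma^~ d). Proof. exact: gammaP.1.1. Qed.
Let gammar c : linear (gamma c). Proof. exact: gammaP.1.2. Qed.

Definition integral_map (M : doiKoppinenType A C) (t : C ⊗ M) : M :=
  \sw_(c, m <- t) \sw_(d, m0 <- lcoact m) (m0 ∙ gamma c d).

Fact integral_map_linear M : linear (@integral_map M).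
Proof. by apply: sweedler_linear; lin. Qed.

Definition integral_hom (M : doiKoppinenType A C) :
    {linear forgetA (cofree C (forgetC M)) -> forgetA M} :=
  HB.pack (@integral_map M) (GRing.isLinear.Build k (C ⊗ M)%type M *:%R
    (@integral_map M) (@integral_map_linear M)).

Lemma integral_homE (M : doiKoppinenType A C) (c : C) (m : M) :
  integral_hom M (c ⊗ m) = \sw_(d, m0 <- lcoact m) (m0 ∙ gamma c d).
Proof. by rewrite /= /integral_map sweedler_tens //; lin. Qed.

(** Coacting on [n ∙ gamma c d] and using coassociativity of [m] produces the right-hand side of the
    integral identity, with [n] acted on by its second factor. The identity then moves the
    comultiplication from [d] to [c]. *)
Lemma integral_hom_lcolinear M : lcolinear (integral_hom M).
Proof.
move=> t; move: t; apply: tensor_ext => [||c m]; try lin.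
rewrite integral_homE lcoact_tens sweedler_sweedler; last by lin.
rewrite (sweedler_lin _ _ (g := fun z => lcoact z)); last by lin.
transitivity (\sw_(d, n <- lcoact m) \sw_(d1, d2 <- comul d)
   \sw_(h, a <- lcoact (gamma c d1)) ((d2 ∙ h) ⊗ (n ∙ a))).
  rewrite -(lcoactA_lin (f := fun d1 d2 n =>
    \sw_(h, a <- lcoact (gamma c d1)) ((d2 ∙ h) ⊗ (n ∙ a)))); try lin.
  apply: eq_sweedler => d n; exact: lcoact_ract.
transitivity (\sw_(d, n <- lcoact m) \sw_(c1, c2 <- comul c)
   (c1 ⊗ (n ∙ gamma c2 d))).
  apply: eq_sweedler => d n.
  pose g (t : C ⊗ A) := \sw_(x, a <- t) (x ⊗ (n ∙ a)).
  have gl : linear g by apply: sweedler_linear; lin.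
  have := congr1 g (gammaP.2 c d); rewrite !(sweedler_lin _ _ gl) => e.
  transitivity (\sw_(d1, d2 <- comul d)
      g (\sw_(h, a <- lcoact (gamma c d1)) ((d2 ∙ h) ⊗ a))).
    apply: eq_sweedler => d1 d2; rewrite (sweedler_lin _ _ gl).
    by apply: eq_sweedler => h a; rewrite /g sweedler_tens //; lin.
  rewrite -e; apply: eq_sweedler => c1 c2.
  by rewrite /g sweedler_tens //; lin.
rewrite exchange_sweedler; apply: eq_sweedler => c1 c2.
rewrite sweedler_tens; last by lin.
by rewrite integral_homE (sweedler_lin _ _ (@tens_linearr _ _ _ _)).
Qed.

Lemma integral_hom_nat_trans : nat_trans integral_hom.
Proof.
split=> [M|M N f fA fC]; first exact: integral_hom_lcolinear.
apply: tensor_ext => [||c m].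
- apply: lin_comp; rewrite /cofree_map; apply: sweedler_linear; lin.
- by lin.
rewrite /cofree_map sweedler_tens; last by lin.
rewrite !integral_homE fC sweedler_sweedler; last by lin.
rewrite (sweedler_lin _ _ (g := fun z => f z)); last by lin.
apply: eq_sweedler => d n; rewrite sweedler_tens; last by lin.
by rewrite fA.
Qed.

(** Coassociativity feeds [c_(1)] and [c_(2)], for [c = m_<-1>], into [gamma], so totality leaves
    the counit axiom of the coaction. *)
Lemma integral_hom_split (M : doiKoppinenType A C) (m : M) :
  is_total gamma -> integral_hom M (lcoact m) = m.
Proof.
move=> gammaT; rewrite /= /integral_map.
rewrite (lcoactA_lin (f := fun c d n => n ∙ gamma c d)); try lin.
rewrite -[RHS]lcoact_counit; apply: eq_sweedler => c n.
rewrite -(sweedler_lin _ _ (@ract_linearr _ _ _ _)) gammaT.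
by rewrite (linZ _ _ (ract_linearr _)) ract1.
Qed.

End IntegralToSplitting.

(** * From natural retractions to a bicomodule retraction *)

Section SplittingToBicomodule.
Variable lambda : forall M : doiKoppinenType A C,
  {linear forgetA (cofree C (forgetC M)) -> forgetA M}.
Hypothesis lambdaN : nat_trans lambda.

(* Naturality with respect to the morphisms [m |-> m ⊗ v]. *)
Lemma nat_trans_tensor (M : doiKoppinenType A C) (V : lmodType k)
    (c : C) (m : M) (v : V) :
  lambda (tensor_dk M V) (c ⊗ (m ⊗ v)) = lambda M (c ⊗ m) ⊗ v.
Proof.
pose f0 (m : M) : tensor_dk M V := m ⊗ v.
have fl : linear f0 by exact: tens_linearl.
pose f : {linear M -> tensor_dk M V} := HB.pack f0
  (GRing.isLinear.Build k M (tensor_dk M V) *:%R f0 fl).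
have fA : rlinear f by move=> n a; rewrite [RHS]tensor_ractE.
have fC : lcolinear f.
  by move=> n; rewrite [LHS]tensor_lcoactE.
have := lambdaN.2 M _ f fA fC (c ⊗ m).
by rewrite /cofree_map sweedler_tens //; lin.
Qed.

Let CA : doiKoppinenType A C := cofree C (regular_module A).

(** On [c ⊗ b] the last factor becomes [c_(2)] times [a_<-2> S(b_<-1> a_<-1>) = a_<-2> S(a_<-1>)
    S(b_<-1>)]. The part of [a] cancels there, and [a] acts on the left factor alone. *)
Lemma rcoactCA_ract (t : CA) (a : A) :
  rcoactCA (t ∙ a) = (rcoactCA t : tensor_dk CA C) ∙ a.
Proof.
move: t; apply: tensor_ext => [||c b].
- by move=> x u v; rewrite (ract_linearl (M := CA) a) linearP.
- by move=> x u v; rewrite linearP (ract_linearl (M := tensor_dk CA C)).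
rewrite ract_tens.
rewrite (sweedler_lin _ _ (g := fun z => rcoactCA z)); last by lin.
rewrite rcoactCAE [RHS](sweedler_lin _ _ (tensor_ract_linearl _)).
transitivity (\sw_(c1, c2 <- comul c) \sw_(h, b0 <- lcoact b)
   \sw_(g, a0 <- lcoact a)
   (((c1 ∙ g) ⊗ (b0 ⋆ a0)) ⊗ (c2 ∙ antipode h))); last first.
  apply: eq_sweedler => c1 c2.
  rewrite (sweedler_lin _ _ (tensor_ract_linearl _)).
  apply: eq_sweedler => h b0; rewrite tensor_ractE ract_tens.
  by rewrite (sweedler_lin _ _ (@tens_linearl _ _ _ _)).
(* Here [g1], [g2], [e] stand for [a_<-3>], [a_<-2>], [a_<-1>]. *)
transitivity (\sw_(g, a0 <- lcoact a) \sw_(c1, c2 <- comul c)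
  \sw_(g1, g2 <- comul g) \sw_(h, b0 <- lcoact b) \sw_(e, a1 <- lcoact a0)
   (((c1 ∙ g1) ⊗ (b0 ⋆ a1)) ⊗ (c2 ∙ (g2 ⋆ (antipode e ⋆ antipode h))))).
  apply: eq_sweedler => g a0; rewrite rcoactCAE comul_ract.
  rewrite sweedler_sweedler; last by lin.
  apply: eq_sweedler => c1 c2; rewrite sweedler_sweedler; last by lin.
  apply: eq_sweedler => g1 g2; rewrite sweedler_tens; last by lin.
  rewrite lcoactM sweedler_sweedler; last by lin.
  apply: eq_sweedler => h b0; rewrite sweedler_sweedler; last by lin.
  apply: eq_sweedler => e a1; rewrite sweedler_tens; last by lin.
  by rewrite -ractA antipodeM.
rewrite exchange_sweedler; apply: eq_sweedler => c1 c2.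
transitivity (\sw_(h, b0 <- lcoact b) \sw_(g, a0 <- lcoact a)
  \sw_(g1, g2 <- comul g) \sw_(e, a1 <- lcoact a0)
   (((c1 ∙ g1) ⊗ (b0 ⋆ a1)) ⊗ (c2 ∙ (g2 ⋆ (antipode e ⋆ antipode h))))).
  rewrite exchange_sweedler; apply: eq_sweedler => g a0.
  by rewrite exchange_sweedler.
apply: eq_sweedler => h b0.
transitivity (\sw_(g, a0 <- lcoact a) \sw_(g', e <- comul g)
  \sw_(g1, g2 <- comul g')
   (((c1 ∙ g1) ⊗ (b0 ⋆ a0)) ⊗ (c2 ∙ (g2 ⋆ (antipode e ⋆ antipode h))))).
  rewrite -(lcoactA_lin (f := fun g e a0 => \sw_(g1, g2 <- comul g)
   (((c1 ∙ g1) ⊗ (b0 ⋆ a0)) ⊗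
     (c2 ∙ (g2 ⋆ (antipode e ⋆ antipode h)))))); try lin.
  by apply: eq_sweedler => g a0; rewrite exchange_sweedler.
apply: eq_sweedler => g a0.
(* After this regrouping [g2] and [e] come from a single comultiplication, so [g2 ⋆ antipode e] sums
   to a counit. *)
rewrite -(comulA_lin (f := fun g1 g2 e =>
   (((c1 ∙ g1) ⊗ (b0 ⋆ a0)) ⊗
     (c2 ∙ (g2 ⋆ (antipode e ⋆ antipode h)))))); try lin.
rewrite -(counit_lin (f := fun z =>
   ((c1 ∙ z) ⊗ (b0 ⋆ a0)) ⊗ (c2 ∙ antipode h)) g _).2; last by lin.
apply: eq_sweedler => g1 g2.
pose m z := ((c1 ∙ g1) ⊗ (b0 ⋆ a0)) ⊗ (c2 ∙ (z ⋆ antipode h)).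
have ml : linear m by rewrite /m; lin.
transitivity (m (counit g2 *: kone)).
  rewrite -antipoder (sweedler_lin _ _ ml); apply: eq_sweedler => x y.
  by rewrite /m kmulA.
by rewrite (linZ _ _ ml) /m kmul1l.
Qed.

Definition bicomodule_splitting : {linear bicomodCCA A C -> bicomodCA A C} :=
  lambda CA.

Lemma bicomodule_splittingP : bicomod_map bicomodule_splitting.
Proof.
split; first exact: (lambdaN.1 CA).
pose f : {linear CA -> tensor_dk CA C} := @rcoactCA _ _ A C.
have fA : rlinear f by exact: rcoactCA_ract.
(* Colinearity of [f] is the compatibility of the two coactions of [C ⊗ A]. *)
have fC : lcolinear f.
  by move=> t; rewrite -[RHS]lrcoactCAA.
move=> t; move: t; apply: tensor_ext => [||c u]; try lin.
have := lambdaN.2 _ _ f fA fC (c ⊗ u).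
rewrite /cofree_map sweedler_tens; last by lin.
move=> /esym e; apply: (etrans e).
(* The right coaction of [C ⊗ C ⊗ A] is that of [C ⊗ A] on the last two factors, and
   [nat_trans_tensor] pulls the new factor [d] out of [lambda]. *)
transitivity (\sw_(n, d <- rcoactCCA (c ⊗ u)) (lambda CA n ⊗ d)); last by [].
rewrite rcoactCCA_tens sweedler_sweedler; last by lin.
rewrite -[f u in LHS]sweedler_id (sweedler_lin _ _ (@tens_linearr _ _ _ _)).
rewrite (sweedler_lin _ _ (g := fun z => lambda _ z)); last by lin.
apply: eq_sweedler => v d; rewrite sweedler_tens; last by lin.
exact: nat_trans_tensor.
Qed.

End SplittingToBicomodule.

(** * From a bicomodule retraction to a total integral *)

Section BicomoduleToIntegral.
Variable lambda : {linear bicomodCCA A C -> bicomodCA A C}.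
Hypothesis lambdaP : bicomod_map lambda.

Definition counit_proj (t : C ⊗ A) : A := \sw_(c, a <- t) (counit c *: a).

Fact counit_proj_linear : linear counit_proj.
Proof. by apply: sweedler_linear; lin. Qed.

Definition splitting_integral (c d : C) : A :=
  counit_proj (lambda (c ⊗ (d ⊗ kone))).

(** The counit axiom of [C]. At a value of [lambda], left colinearity turns it into the left-hand
    side of the integral identity. *)
Lemma counit_proj_lcoact (t : bicomodCA A C) :
  \sw_(c, n <- lcoact t) (c ⊗ counit_proj n) = t.
Proof.
have l := counit_proj_linear.
move: t; apply: tensor_ext => [||c a]; try lin.
rewrite lcoact_bicomodCA sweedler_sweedler; last by lin.
rewrite -(counit_lin (f := fun z => z ⊗ a) c _).2; last by lin.
apply: eq_sweedler => c1 c2; rewrite sweedler_tens; last by lin.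
by rewrite /counit_proj sweedler_tens ?tensZr //; lin.
Qed.

(* This says that [c ⊗ a |-> c a_<-1> ⊗ a_<0>] is left inverse to
   [c ⊗ a |-> c S(a_<-1>) ⊗ a_<0>]. *)
Lemma counit_proj_rcoact (t : bicomodCA A C) :
  \sw_(n, c <- rcoact t) \sw_(h, a <- lcoact (counit_proj n)) ((c ∙ h) ⊗ a) = t.
Proof.
have l := counit_proj_linear.
move: t; apply: tensor_ext => [||c b]; try lin.
rewrite rcoact_bicomodCA sweedler_sweedler; last by lin.
transitivity (\sw_(c1, c2 <- comul c) (counit c1 *: (c2 ⊗ b))); last first.
  by rewrite (counit_lin (f := fun z => z ⊗ b) c _).1 //; lin.
apply: eq_sweedler => c1 c2; rewrite sweedler_sweedler; last by lin.
(* The two coordinates of [b] meet as [S(b_<-2>) b_<-1>], which [antipodel] reduces to a counit once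
   coassociativity groups them. *)
transitivity (\sw_(h, b0 <- lcoact b) \sw_(g, a <- lcoact b0)
   (counit c1 *: ((c2 ∙ (antipode h ⋆ g)) ⊗ a))).
  apply: eq_sweedler => h b0; rewrite sweedler_tens; last by lin.
  rewrite /counit_proj sweedler_tens; last by lin.
  rewrite linearZ (linZ _ _ (sweedler_linear _)); last by lin.
  by rewrite scale_sweedler; apply: eq_sweedler => g a; rewrite ractA.
rewrite (lcoactA_lin (f := fun h g a =>
   counit c1 *: ((c2 ∙ (antipode h ⋆ g)) ⊗ a))); try lin.
rewrite -[in RHS](lcoact_counit b).
pose m (z : A) := counit c1 *: (c2 ⊗ z).
have ml : linear m by rewrite /m; lin.
rewrite -/(m _) (sweedler_lin _ _ ml); apply: eq_sweedler => h b0.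
pose p (z : H) := counit c1 *: ((c2 ∙ z) ⊗ b0).
have pl : linear p by rewrite /p; lin.
by rewrite -(sweedler_lin _ _ pl) antipodel (linZ _ _ pl) (linZ _ _ ml) /p ract1.
Qed.

Lemma splitting_integralP : is_integral splitting_integral.
Proof.
have l := counit_proj_linear.
split=> [|c d].
  pose e (t : C ⊗ (C ⊗ A)) : A := counit_proj (lambda t).
  have el : linear e by move=> x u v; rewrite /e linearP; exact: l.
  split=> [d|c] x u v.
    exact: etrans (congr1 e (tens_linearl _ _ _ _)) (el _ _ _).
  by rewrite /splitting_integral -/(e _) tens_linearl tens_linearr el.
transitivity (lambda (c ⊗ (d ⊗ kone))).
  rewrite -[RHS]counit_proj_lcoact lambdaP.1 lcoact_bicomodCCA.
  rewrite sweedler_sweedler; last by lin.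
  rewrite sweedler_sweedler; last by lin.
  apply: eq_sweedler => c1 c2; rewrite sweedler_tens; last by lin.
  by rewrite sweedler_tens //; lin.
rewrite -[LHS]counit_proj_rcoact lambdaP.2 rcoact_bicomodCCA.
rewrite sweedler_sweedler; last by lin.
rewrite sweedler_sweedler; last by lin.
(* Since the unit coacts trivially and [S] fixes the unit of [H], the right coaction of [c ⊗ d ⊗ 1]
   only comultiplies [d]. *)
apply: eq_sweedler => d1 d2; rewrite lcoact1 sweedler_tens; last by lin.
rewrite antipode1 ract1 sweedler_tens; last by lin.
by rewrite sweedler_tens //; lin.
Qed.

(** Apply [counit_proj] to the retraction identity at [c ⊗ 1]. *)
Lemma splitting_integral_total :
  (forall t : bicomodCA A C, lambda (lcoact t) = t) ->
  is_total splitting_integral.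
Proof.
have l := counit_proj_linear.
move=> lambdaK c; transitivity (counit_proj (c ⊗ kone)); last first.
  by rewrite /counit_proj sweedler_tens //; lin.
rewrite -[c ⊗ kone in RHS]lambdaK lcoact_bicomodCA.
rewrite (sweedler_lin _ _ (g := fun z => lambda z)); last by lin.
by rewrite (sweedler_lin _ _ l).
Qed.

End BicomoduleToIntegral.

(** The extension composes the coaction of [V], the map [C ⊗ (f p)] of cofree comodules, and [r].
    The middle map is colinear for every k-linear [p]. *)
Lemma lcolinear_splitting_injective (M : lcomodType C)
    (r : {linear (C ⊗ M)%type -> M}) :
  lcolinear r -> (forall m : M, r (lcoact m) = m) -> relative_injective M.
Proof.
move=> rC rK U V i f iC [p pK] fC.
pose g0 (v : V) : M := \sw_(c, w <- lcoact v) r (c ⊗ f (p w)).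
have gl : linear g0 by rewrite /g0; lin.
pose g : {linear V -> M} := HB.pack g0
  (GRing.isLinear.Build k V M *:%R g0 gl).
exists g; split=> [v|u] /=; last first.
  (* Colinearity of [i] brings [p] next to [i], and colinearity of [f] leaves [r] applied to the
     coaction of [f u]. *)
  rewrite /g0 iC sweedler_sweedler; last by lin.
  rewrite -[RHS]rK fC (sweedler_lin _ _ (g := fun z => r z)); last by lin.
  by apply: eq_sweedler => c w; rewrite sweedler_tens ?pK //; lin.
rewrite /g0 (sweedler_lin _ _ (g := fun z => lcoact z)); last by lin.
transitivity (\sw_(c, w <- lcoact v) \sw_(c1, c2 <- comul c)
    (c1 ⊗ r (c2 ⊗ f (p w)))).
  apply: eq_sweedler => c w; rewrite rC lcoact_tens sweedler_sweedler; last by lin.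
  by apply: eq_sweedler => c1 c2; rewrite sweedler_tens //; lin.
rewrite -(lcoactA_lin (f := fun c1 c2 w => c1 ⊗ r (c2 ⊗ f (p w)))); try lin.
apply: eq_sweedler => c w.
by rewrite -(sweedler_lin _ _ (@tens_linearr _ _ _ _)).
Qed.

End Datum.

Theorem theorem3p6 (k : comPzRingType) (H : hopfType k)
    (A : comodAlgType H) (C : modCoalgType H) :
  let total_integral :=
    exists gamma : C -> C -> A, is_integral gamma /\ is_total gamma in
  let coaction_splits :=
    exists lambda : forall M : doiKoppinenType A C,
        {linear forgetA (cofree C (forgetC M)) -> forgetA M},
      nat_trans lambda /\
      forall (M : doiKoppinenType A C) (m : forgetA M),
        lambda M (lcoact m) = m in
  let bicomodule_splits :=
    exists lambda : {linear bicomodCCA A C -> bicomodCA A C},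
      bicomod_map lambda /\
      forall t : bicomodCA A C, lambda (lcoact t) = t in
  [/\ total_integral <-> coaction_splits,
      coaction_splits <-> bicomodule_splits
    & total_integral \/ coaction_splits \/ bicomodule_splits ->
      forall M : doiKoppinenType A C, relative_injective (forgetA M)].
Proof.
move=> total_integral coaction_splits bicomodule_splits.
(* Three implications in a cycle yield both equivalences. *)
have integral_coaction : total_integral -> coaction_splits.
  case=> gamma [gammaP gammaT]; exists (integral_hom gammaP).
  split; first exact: integral_hom_nat_trans.
  by move=> M m; exact: integral_hom_split.
have coaction_bicomodule : coaction_splits -> bicomodule_splits.
  case=> lambda [lambdaN lambdaK]; exists (bicomodule_splitting lambda).
  split; first exact: bicomodule_splittingP.
  exact: (lambdaK (cofree C (regular_module A))).
have bicomodule_integral : bicomodule_splits -> total_integral.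
  case=> lambda [lambdaP lambdaK]; exists (splitting_integral lambda).
  split; first exact: splitting_integralP.
  exact: splitting_integral_total.
split; [by split=> *; auto | by split=> *; auto |].
move=> splits M.
have [lambda [lambdaN lambdaK]] : coaction_splits by case: splits => [|[]]; auto.
exact: (lcolinear_splitting_injective (lambdaN.1 M) (lambdaK M)).
Qed.
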